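(* Let $\nu>0$, $n\ge 1$. There is a constant $C>0$ depending only on $\nu$ such that the following holds. Let $h:\mathbb{R}\times\mathbb{R}^n\to\mathbb{R}$, $(x,\mathbf{y})\mapsto h(x,\mathbf{y})$, be a $C^2$ map with bounded partial derivatives (of orders one and two), and let $f_h$ be the unique bounded solution of $$2(x+\nu)\frac{\partial f}{\partial x}(x,\mathbf{y})-xf(x,\mathbf{y})=h(x,\mathbf{y})-\mathbf{E}\left[h(Z_\nu,\mathbf{y})\right],\qquad (x,\mathbf{y})\in\mathbb{R}\times\mathbb{R}^n,$$ where $Z_\nu\sim F(\nu)$. Then $$\|f_h\|_\infty\le C\left\|\frac{\partial h}{\partial x}\right\|_\infty,$$ and, for every $j\in\{1,\dots,n\}$, $$\left\|\frac{\partial f_h}{\partial y_j}\right\|_\infty\le C\left\|\frac{\partial^2h}{\partial x\,\partial y_j}\right\|_\infty\quad\text{and}\quad \left\|\frac{\partial f_h}{\partial x}\right\|_\infty\le C\left\|\frac{\partial h}{\partial x}\right\|_\infty.$$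
   Context: For $\nu>0$, $F(\nu)$ denotes the centered Gamma distribution with parameter $\nu$, i.e. the probability law on $\mathbb{R}$ with density $$p_\nu(x)=\frac{(x+\nu)^{\frac{\nu}{2}-1}e^{-\frac{x+\nu}{2}}}{2^{\frac{\nu}{2}}\Gamma\left(\frac{\nu}{2}\right)}\mathbf{1}_{(-\nu,+\infty)}(x).$$ The function $q_\nu$ is defined by $$q_\nu(x)=\frac{(-(x+\nu))^{\frac{\nu}{2}-1}e^{-\frac{x+\nu}{2}}}{2^{\frac{\nu}{2}}\Gamma\left(\frac{\nu}{2}\right)}\mathbf{1}_{(-\infty,-\nu)}(x).$$ The unique bounded solution $f_h$ of the equation is given explicitly by $$\begin{aligned} f_h(x,\mathbf{y})={}&\left[\int_{-\nu}^{x}\frac{p_\nu(u)}{2(x+\nu)p_\nu(x)}\left(h(u,\mathbf{y})-\mathbf{E}[h(Z_\nu,\mathbf{y})]\right)\mathrm{d}u\right]\mathbf{1}_{(-\nu,+\infty)}(x)\\ &-\left[\int_{x}^{-\nu}\frac{q_\nu(u)}{2(x+\nu)q_\nu(x)}\left(h(u,\mathbf{y})-\mathbf{E}[h(Z_\nu,\mathbf{y})]\right)\mathrm{d}u\right]\mathbf{1}_{(-\infty,-\nu)}(x)\\ &+\frac{h(-\nu,\mathbf{y})-\mathbf{E}[h(Z_\nu,\mathbf{y})]}{\nu}\mathbf{1}_{\{-\nu\}}(x).\end{aligned}$$ $\|\cdot\|_\infty$ denotes the supremum norm over $\mathbb{R}\times\mathbb{R}^n$. *)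

(* Defs.v *)
From HB Require Import structures.
From mathcomp Require Import all_boot all_order all_algebra.
From mathcomp Require Import all_classical all_reals all_analysis.

Set Implicit Arguments.
Unset Strict Implicit.
Unset Printing Implicit Defensive.

Import Order.TTheory GRing.Theory Num.Theory.
Import numFieldNormedType.Exports.

Local Open Scope classical_set_scope.
Local Open Scope ring_scope.

(* Euler's integral; the Gamma function only for s > 0. *)
Definition Gamma {R : realType} (s : R) : R :=
  \int[lebesgue_measure]_(t in `]0, +oo[) (t `^ (s - 1) * expR (- t)).

(* p_ nu is the density of F(nu).  In p_, q_ and stein_solution below, the
   values taken by `^ at a nonpositive base and by division by 0 only occur
   where the indicator vanishes. *)
Definition p_ {R : realType} (nu x : R) : R :=
  (x + nu) `^ (nu / 2 - 1) * expR (- ((x + nu) / 2))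
    / (2 `^ (nu / 2) * Gamma (nu / 2)) * \1_(`]- nu, +oo[) x.

Definition q_ {R : realType} (nu x : R) : R :=
  (- (x + nu)) `^ (nu / 2 - 1) * expR (- ((x + nu) / 2))
    / (2 `^ (nu / 2) * Gamma (nu / 2)) * \1_(`]-oo, - nu[) x.

(* Z ~ F(nu), the centered Gamma law. *)
Definition centered_gamma {R : realType} (nu : R) {d : measure_display}
    {Om : measurableType d} (P : probability Om R) (Z : {RV P >-> R}) : Prop :=
  forall A : set R, measurable A ->
    distribution P Z A = (\int[lebesgue_measure]_(x in A) (p_ nu x)%:E)%E.

(* The coordinate directions of R x R^n: 'D_dx and 'D_(dy j) are the partial
   derivatives in x and in y_j. *)
Definition dx {R : realType} {n : nat} : R * 'rV[R]_n := (1, 0).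
Definition dy {R : realType} {n : nat} (j : 'I_n) : R * 'rV[R]_n :=
  (0, delta_mx 0 j).

Definition coord_dir {R : realType} {n : nat} (i : option 'I_n) :
    R * 'rV[R]_n :=
  if i is Some j then dy j else dx.

Definition C1 {R : realType} {n : nat} (h : R * 'rV[R]_n -> R) : Prop :=
  forall i : option 'I_n,
    (forall p, derivable h p (coord_dir i)) /\ continuous ('D_(coord_dir i) h).

Definition C2 {R : realType} {n : nat} (h : R * 'rV[R]_n -> R) : Prop :=
  C1 h /\ forall i : option 'I_n, C1 ('D_(coord_dir i) h).

Definition bounded_partials {R : realType} {n : nat} (h : R * 'rV[R]_n -> R) :
    Prop :=
  (forall i : option 'I_n, bounded_fun ('D_(coord_dir i) h)) /\
  (forall i k : option 'I_n,
     bounded_fun ('D_(coord_dir i) ('D_(coord_dir k) h))).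

(* Extended-real valued, so that an unbounded g has norm +oo. *)
Definition supnorm {R : realType} {n : nat} (g : R * 'rV[R]_n -> R) : \bar R :=
  ereal_sup [set `|g p|%:E | p in [set: R * 'rV[R]_n]].

(* h(x,y) - E[h(Z,y)] *)
Definition centered {R : realType} {n : nat} {d : measure_display}
    {Om : measurableType d} (P : probability Om R) (Z : {RV P >-> R})
    (h : R * 'rV[R]_n -> R) (x : R) (y : 'rV[R]_n) : R :=
  h (x, y) - fine ('E_P[fun w => h (Z w, y)])%E.

Definition bounded_solution {R : realType} {n : nat} (nu : R)
    {d : measure_display} {Om : measurableType d} (P : probability Om R)
    (Z : {RV P >-> R}) (h f : R * 'rV[R]_n -> R) : Prop :=
  bounded_fun f /\
  forall (x : R) (y : 'rV[R]_n),
    derivable f (x, y) dx /\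
    2 * (x + nu) * 'D_dx f (x, y) - x * f (x, y) = centered Z h x y.

Definition stein_solution {R : realType} {n : nat} (nu : R)
    {d : measure_display} {Om : measurableType d} (P : probability Om R)
    (Z : {RV P >-> R}) (h : R * 'rV[R]_n -> R) : R * 'rV[R]_n -> R :=
  fun '(x, y) =>
    (\int[lebesgue_measure]_(u in `[- nu, x])
       (p_ nu u / (2 * (x + nu) * p_ nu x) * centered Z h u y))
      * \1_(`]- nu, +oo[) x
  - (\int[lebesgue_measure]_(u in `[x, - nu])
       (q_ nu u / (2 * (x + nu) * q_ nu x) * centered Z h u y))
      * \1_(`]-oo, - nu[) x
  + centered Z h (- nu) y / nu * \1_([set - nu]) x.

(* Main.v *)
(* With t = x + nu and w(t) = |t|^(nu/2 - 1) e^(-t/2), one has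
   (2 t w)' = (nu - t) w, so that on each side of t = 0 the bounded solution is
   f = (2 t w)^-1 \int_0^t w H with H = h - E h(Z). The bounds, all with C = 1,
   follow by comparing first-order quantities that vanish at t = 0. Let L bound
   |dh/dx|.
   - For t > 0, L x + H and L x - H are nondecreasing in x with nonpositive
     mean, so their integrals against w over (0, t) are nonpositive, whereas
     \int_0^t w(s) (s - nu) ds = - 2 t w(t); hence |f| <= L. For t < 0,
     |H| <= L (nu - t) and \int_t^0 w(s) (nu - s) ds = 2 |t| w(t).
   - M = 2 t^2 w f' satisfies M' = t w (dh/dx + f), which is at most 2 L |t| w,
     while (t^2 w)' = (nu/2 + 1 - t/2) t w; this bounds f' for t <= nu. For
     t >= nu, the equation and |H| <= L (|x| + 2 nu) suffice.
   - The same comparison, applied to f minus its first-order expansion, gives the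
     derivative at t = 0.
   - Differentiation under the integral sign shows that df_h/dy_j is the solution
     associated with dh/dy_j, to which the bound on f applies. *)
Require Import Defs.
From HB Require Import structures.
From mathcomp Require Import all_boot all_order all_algebra.
From mathcomp Require Import all_classical all_reals all_analysis.
From mathcomp Require Import measurable_realfun.
From mathcomp Require Import ring lra.
Set Implicit Arguments.
Unset Strict Implicit.
Unset Printing Implicit Defensive.
Import Order.TTheory GRing.Theory Num.Theory.
Import numFieldNormedType.Exports.
Local Open Scope classical_set_scope.
Local Open Scope ring_scope.

(** * Comparison and the equation on a half-line *)

(** The mean value theorem on [[s, T]] gives [(g - f) s <= (g - f) T], and the left side tends to 0
    as [s] decreases to 0. Since only limits at [0^'+] enter, the derivatives may blow up there, as
    [r^(a - 1)] does for [a < 1]. *)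
Lemma le_of_derive_at_right0 (R : realType) (f g df dg : R -> R) (T : R) :
  0 < T -> f x @[x --> 0^'+] --> 0 -> g x @[x --> 0^'+] --> 0 ->
  (forall r, 0 < r <= T -> is_derive r 1 f (df r)) ->
  (forall r, 0 < r <= T -> is_derive r 1 g (dg r)) ->
  (forall r, 0 < r <= T -> df r <= dg r) -> f T <= g T.
Proof.
move=> T0 f0 g0 f_df g_dg le_d.
rewrite -subr_ge0.
have d0 : (g - f) x @[x --> 0^'+] --> 0.
  by rewrite -[X in _ --> X](subr0 0); exact: cvgB.
rewrite -[leRHS]/((g - f) T).
apply: (cvgr_to_le d0).
near=> s.
have s0 : 0 < s by [].
have sT : s < T by near: s; exact: nbhs_right_lt.
have drv x : s <= x <= T -> is_derive x 1 (g - f) (dg x - df x).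
  move=> /andP[sx xT]; apply: is_deriveB.
    by apply: g_dg; rewrite xT (lt_le_trans s0).
  by apply: f_df; rewrite xT (lt_le_trans s0).
have [x||c] := @MVT_segment R (g - f) (dg \- df) s T (ltW sT).
- by rewrite in_itv/= => /andP[/ltW sx /ltW xT]; apply: drv; rewrite sx.
- apply: derivable_within_continuous => y; rewrite in_itv/= => /drv.
  by case.
rewrite in_itv/= => /andP[sc cT] e.
rewrite -subr_ge0 e mulr_ge0 ?subr_ge0 ?(ltW sT)// le_d// cT andbT.
exact: lt_le_trans sc.
Unshelve. all: by end_near. Qed.

Lemma norm_le_of_derive_at_right0 (R : realType) (f g df dg : R -> R) (T : R) :
  0 < T -> f x @[x --> 0^'+] --> 0 -> g x @[x --> 0^'+] --> 0 ->
  (forall r, 0 < r <= T -> is_derive r 1 f (df r)) ->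
  (forall r, 0 < r <= T -> is_derive r 1 g (dg r)) ->
  (forall r, 0 < r <= T -> `|df r| <= dg r) -> `|f T| <= g T.
Proof.
move=> T0 f0 g0 f_df g_dg le_d; rewrite ler_norml lerNl; apply/andP; split.
  rewrite -[leLHS]/((- f) T).
  apply: (@le_of_derive_at_right0 R (- f) g (- df) dg) => //.
  - by rewrite -[X in _ --> X]oppr0; exact: cvgN.
  - by move=> r /f_df ?; exact: is_deriveN.
  - by move=> r /le_d; rewrite ler_norml lerNl => /andP[].
apply: (@le_of_derive_at_right0 R f g df dg) => // r /le_d.
by rewrite ler_norml => /andP[].
Qed.

(* With a = nu / 2, the density of F(nu) at - nu + r and the function q_nu at
   - nu - r are proportional to expPow (a - 1) s r with s = 1 and s = - 1. *)
Definition expPow {R : realType} (a s r : R) : R :=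
  r `^ a * expR (- (s * r / 2)).

Lemma expPow_gt0 (R : realType) (a s r : R) : 0 < r -> 0 < expPow a s r.
Proof. by move=> r0; rewrite mulr_gt0 ?powR_gt0 ?expR_gt0. Qed.

Lemma mulr_expPow (R : realType) (a s r : R) : 0 < r ->
  r * expPow (a - 1) s r = expPow a s r.
Proof.
move=> r0; rewrite /expPow mulrA; congr (_ * _).
have rn0 : r != 0 by rewrite gt_eqF.
rewrite -[X in X * _](powRr1 (ltW r0)) -powRD ?rn0 ?implybT//.
by rewrite addrC subrK.
Qed.

Lemma is_derive_expPow (R : realType) (a s r : R) : 0 < r ->
  is_derive r 1 (expPow a s) ((a - s * r / 2) * expPow (a - 1) s r).
Proof.
move=> r0.
have de : is_derive r 1 (fun r => expR (- (s * r / 2)))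
    (expR (- (s * r / 2)) * (- (s / 2))).
  apply: (@is_derive1_comp R expR (fun r => - (s * r / 2))).
  rewrite (_ : (fun _ => _) = (- (s / 2)) \*: (id : R -> R)); last first.
    by apply/funext => x /=; rewrite /GRing.scale/=; ring.
  apply: is_derive_eq.
  by rewrite /GRing.scale/= mulr1.
have := is_deriveM (is_derive1_powR a r0) de.
rewrite -[X in is_derive _ _ X _]/(expPow a s) => h.
apply: is_derive_eq h _.
rewrite /GRing.scale/=.
rewrite mulrA -/(expPow a s r) -(mulr_expPow a s r0) /expPow.
by field.
Qed.

Lemma expPow_cvg0 (R : realType) (a s : R) : 0 < a ->
  expPow a s r @[r --> 0^'+] --> 0.
Proof.
move=> a0.
rewrite -[X in _ --> X](mul0r (expR (- (s * 0 / 2)))).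
apply: cvgM; first exact: powR_cvg0.
apply: cvg_at_right_filter.
apply: continuous_comp; last exact: continuous_expR.
by apply: cvgN; apply: cvgMl; apply: cvgMr.
Qed.

(** * The first-order equation on a half-line *)

Section half_line.
Variables (R : realType) (a s : R) (K J : R -> R).
Implicit Types r : R.
Hypothesis a_gt0 : 0 < a.
Hypothesis J_df : forall r, 0 < r ->
  is_derive r 1 J (expPow (a - 1) s r * K r).
Hypothesis J0 : J r @[r --> 0^'+] --> 0.

(** A solution of [2 r G' + (2 a - s r) G = K] by an integrating factor. With [2 a = nu] and
    [r = |x + nu|] this is the Stein equation, on the right of [- nu] for [s = 1] and on the left
    for [s = - 1]. *)
Definition half_solution (r : R) : R := J r / (2 * expPow a s r).

Lemma half_solutionE r : 0 < r -> J r = 2 * expPow a s r * half_solution r.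
Proof.
move=> r0; rewrite /half_solution mulrCA divff ?mulr1//.
by rewrite mulf_neq0 ?pnatr_eq0// gt_eqF// expPow_gt0.
Qed.

Lemma is_derive_half_solution r : 0 < r ->
  is_derive r 1 half_solution ((K r - (2 * a - s * r) * half_solution r) / (2 * r)).
Proof.
move=> r0.
have A0 : expPow a s r != 0 by rewrite gt_eqF ?expPow_gt0.
have rn0 : r != 0 by rewrite gt_eqF.
have dA := is_derive_expPow a s r0.
have A2 : ((cst 2 : R -> R) * expPow a s) r != 0.
  by rewrite fctE/= mulf_neq0 ?pnatr_eq0.
have dI := is_deriveV A2 (is_deriveM (is_derive_cst (2 : R) r 1) dA).
have h := is_deriveM (J_df r0) dI.
apply: (is_derive_eq h).
rewrite /GRing.scale/= half_solutionE// !fctE.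
rewrite -(mulr_expPow a s r0) in A0 *.
have W0 : expPow (a - 1) s r != 0 by rewrite gt_eqF ?expPow_gt0.
by field; rewrite rn0 W0.
Qed.

(** The constant [L] solves the equation with right-hand side [L (2 a - s r)], so the comparison is
    between [J] and [2 L expPow a s]. For [s = - 1] the bound required of [K] grows with [r]; for
    [s = 1] it degenerates as [r] approaches [2 a]. *)
Lemma half_solution_norm_le (L : R) (T : R) : 0 < T ->
  (forall r, 0 < r <= T -> `|K r| <= L * (2 * a - s * r)) ->
  `|half_solution T| <= L.
Proof.
move=> T0 K_le.
have A0 := expPow_gt0 a s T0.
have A2 : 0 < 2 * expPow a s T by rewrite mulr_gt0.
rewrite /half_solution normf_div (gtr0_norm A2) ler_pdivrMr//.
apply: (@norm_le_of_derive_at_right0 R J (fun r => L * (2 * expPow a s r))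
  (fun r => expPow (a - 1) s r * K r)
  (fun r => expPow (a - 1) s r * (L * (2 * a - s * r)))) => //.
- rewrite -[X in _ --> X](mulr0 L); apply: cvgMr.
  by rewrite -[X in _ --> X](mulr0 2); apply: cvgMr; exact: expPow_cvg0.
- by move=> r /andP[r0 _]; exact: J_df.
- move=> r /andP[r0 _].
  have h := is_deriveZ L (is_deriveZ 2 (is_derive_expPow a s r0)).
  apply: (is_derive_eq h).
  by rewrite /GRing.scale/=; field.
- move=> r /[dup] r0T /andP[r0 _].
  rewrite normrM gtr0_norm ?expPow_gt0// ler_pM2l ?expPow_gt0//.
  exact: K_le.
Qed.

(* The function 2 r^(a + 1) e^(- s r / 2) G'(r), with G := half_solution, has
   derivative r^a e^(- s r / 2) (K'(r) + s G(r)). *)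
Lemma half_solution_derive_norm_le (K' : R -> R) (B T : R) : 0 < T -> s * T / 2 <= a ->
  (forall r, 0 < r <= T -> is_derive r 1 K (K' r)) ->
  cvg (K r @[r --> 0^'+]) ->
  (forall r, 0 < r <= T -> `|K' r + s * half_solution r| <= 2 * B) ->
  `|(K T - (2 * a - s * T) * half_solution T) / (2 * T)| <= B.
Proof.
move=> T0 sT K_df /cvg_ex[/= K0 cK] le_B.
have A0 := expPow_gt0 a s T0.
have P0 := expPow_gt0 (a + 1) s T0.
(* [M] is [2 expPow (a + 1) s] times the derivative of the solution, rewritten by the equation
   without division. Its limit 0 is then visible: [expPow a s] and [J] vanish at 0 while [K]
   converges. *)
pose M r := expPow a s r * K r - (a - s * r / 2) * J r.
have ME r : 0 < r ->
    M r = 2 * expPow (a + 1) s r * ((K r - (2 * a - s * r) * half_solution r) / (2 * r)).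
  move=> r0.
  have rn0 : r != 0 by rewrite gt_eqF.
  rewrite /M half_solutionE// -(mulr_expPow (a + 1) s r0) addrK.
  by field.
suff : `|M T| <= 2 * B * expPow (a + 1) s T.
  have P2 : 0 < 2 * expPow (a + 1) s T by rewrite mulr_gt0.
  rewrite ME// normrM (gtr0_norm P2).
  have -> : 2 * B * expPow (a + 1) s T = 2 * expPow (a + 1) s T * B by ring.
  by rewrite ler_pM2l.
have B0 : 0 <= 2 * B by rewrite (le_trans _ (le_B T _))// T0 lexx.
apply: (@norm_le_of_derive_at_right0 R M (fun r => 2 * B * expPow (a + 1) s r)
  (fun r => expPow a s r * (K' r + s * half_solution r))
  (fun r => 2 * B * ((a + 1 - s * r / 2) * expPow a s r))) => //.
- rewrite -[X in _ --> X](subrr 0); apply: cvgB.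
    by rewrite -[X in _ --> X](mul0r K0); apply: cvgM => //; exact: expPow_cvg0.
  rewrite -[X in _ --> X](mulr0 (a - s * 0 / 2)); apply: cvgM => //.
  apply: cvg_at_right_filter; apply: cvgB; first exact: cvg_cst.
  by apply: cvgMl; apply: cvgMr.
- by rewrite -[X in _ --> X](mulr0 (2 * B)); apply: cvgMr; apply: expPow_cvg0;
    rewrite addr_gt0.
- move=> r /[dup] r0T /andP[r0 _].
  have rn0 : r != 0 by rewrite gt_eqF.
  have dl : is_derive r 1 (fun r => a - s * r / 2) (- (s / 2)).
    rewrite (_ : (fun _ => _) = (cst a : R -> R) - (s / 2) \*: (id : R -> R)).
      by apply: is_derive_eq; rewrite /GRing.scale/= sub0r mulr1.
    apply/funext => x; rewrite (_ : (cst a - (s / 2) \*: id) x = a - s / 2 * x)//.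
    by ring.
  have h := is_deriveB (is_deriveM (is_derive_expPow a s r0) (K_df _ r0T))
    (is_deriveM dl (J_df r0)).
  apply: (is_derive_eq h).
  rewrite /GRing.scale/= half_solutionE// -(mulr_expPow a s r0).
  by field.
- move=> r /andP[r0 _].
  have h := is_deriveZ (2 * B) (is_derive_expPow (a + 1) s r0).
  apply: (is_derive_eq h).
  by rewrite /GRing.scale/= addrK.
- move=> r /[dup] r0T /andP[r0 rT].
  rewrite normrM gtr0_norm ?expPow_gt0// mulrC [leRHS]mulrA ler_pM2r ?expPow_gt0//.
  rewrite (le_trans (le_B _ r0T))// ler_peMr//.
  (* The condition at [T] passes down to every [r <= T] and makes the factor [a + 1 - s r / 2] at
     least 1. *)
  suff : s * r / 2 <= a by lra.
  have [s0|s0] := leP s 0.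
    by rewrite (le_trans _ (ltW a_gt0))// mulr_le0_ge0// mulr_le0_ge0// ltW.
  apply: le_trans sT; rewrite ler_pM2r// ler_pM2l//.
Qed.

(** Inserting [g0 + kap r] into the equation forces [2 a g0 = k0] and [2 (a + 1) kap = m + s g0].
    The remainder times [2 expPow a s] is [N] below, whose derivative involves only the remainder of
    [K] and a quadratic term; it is compared with [2 e expPow (a + 1) s]. *)
Lemma half_solution_slope_at_right0 (m k0 : R) :
  (forall e, 0 < e -> \forall r \near 0^'+, `|K r - k0 - m * r| <= e * r) ->
  forall e, 0 < e -> \forall r \near 0^'+,
    `|half_solution r - k0 / (2 * a) - (m + s * (k0 / (2 * a))) / (2 * (a + 1)) * r|
      <= e * r.
Proof.
move=> K_slope e e0.
set g0 := k0 / (2 * a); set kap := (m + s * g0) / (2 * (a + 1)).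
have an0 : a != 0 by rewrite gt_eqF.
have a1n0 : a + 1 != 0 by rewrite gt_eqF// addr_gt0.
have [d /= d0 Kd] := K_slope e e0.
near=> T.
have T0 : 0 < T by [].
have A0 := expPow_gt0 a s T0.
have A2 : 0 < 2 * expPow a s T by rewrite mulr_gt0.
(* Each part costs [e * r]: the first by the expansion of [K], the second because it is quadratic
   and [T] is small. The [+ 1] in the thresholds keeps the divisors positive. *)
have small r : 0 < r <= T ->
    `|K r - k0 - m * r + kap * s * r ^+ 2| <= 2 * e * r.
  move=> /andP[r0 rT].
  have h1 : `|K r - k0 - m * r| <= e * r.
    apply: Kd => //=; rewrite sub0r normrN gtr0_norm// (le_lt_trans rT)//.
  have h2 : `|kap * s * r ^+ 2| <= e * r.
    rewrite expr2 mulrA normrM (gtr0_norm r0) ler_pM2r// normrM (gtr0_norm r0).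
    rewrite (@le_trans _ _ ((`|kap * s| + 1) * T))//.
      by rewrite ler_pM// ?lerDl// ltW.
    rewrite mulrC -ler_pdivlMr ?ltr_wpDl//.
    near: T; apply: nbhs_right_le; rewrite divr_gt0 ?ltr_wpDl//.
  by rewrite (le_trans (ler_normD _ _))//; lra.
have low r : 0 < r <= T -> s * r / 2 <= a.
  move=> /andP[r0 rT].
  rewrite ler_pdivrMr// (@le_trans _ _ ((`|s| + 1) * T))//.
    rewrite (@le_trans _ _ ((`|s| + 1) * r))// ?ler_pM2r ?ler_pM2l ?ltr_wpDl//.
    by rewrite (le_trans (ler_norm s))// lerDl.
  rewrite mulrC -ler_pdivlMr ?ltr_wpDl//.
  by near: T; apply: nbhs_right_le; rewrite divr_gt0 ?mulr_gt0 ?ltr_wpDl.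
pose N r := J r - (2 * g0 * expPow a s r + 2 * kap * expPow (a + 1) s r).
have NE : N T = 2 * expPow a s T * (half_solution T - g0 - kap * T).
  by rewrite /N half_solutionE// -(mulr_expPow (a + 1) s T0) addrK; ring.
suff : `|N T| <= 2 * e * expPow (a + 1) s T.
  rewrite NE normrM gtr0_norm// -(mulr_expPow (a + 1) s T0) addrK.
  by rewrite [leRHS](_ : _ = 2 * expPow a s T * (e * T)) ?ler_pM2l//; ring.
apply: (@norm_le_of_derive_at_right0 R N (fun r => 2 * e * expPow (a + 1) s r)
  (fun r => expPow (a - 1) s r * (K r - k0 - m * r + kap * s * r ^+ 2))
  (fun r => 2 * e * ((a + 1 - s * r / 2) * expPow a s r))) => //.
- rewrite -[X in _ --> X](subrr 0); apply: cvgB => //.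
  rewrite -[X in _ --> X](addr0 0); apply: cvgD.
    by rewrite -[X in _ --> X](mulr0 (2 * g0)); apply: cvgMr; apply: expPow_cvg0.
  by rewrite -[X in _ --> X](mulr0 (2 * kap)); apply: cvgMr; apply: expPow_cvg0;
    rewrite addr_gt0.
- by rewrite -[X in _ --> X](mulr0 (2 * e)); apply: cvgMr; apply: expPow_cvg0;
    rewrite addr_gt0.
- move=> r /andP[r0 _].
  have h := is_deriveB (J_df r0)
    (is_deriveD (is_deriveZ (2 * g0) (is_derive_expPow a s r0))
       (is_deriveZ (2 * kap) (is_derive_expPow (a + 1) s r0))).
  apply: (is_derive_eq h).
  rewrite /GRing.scale/= addrK -(mulr_expPow a s r0) /kap /g0.
  by field; rewrite an0 a1n0.
- move=> r /andP[r0 _].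
  have h := is_deriveZ (2 * e) (is_derive_expPow (a + 1) s r0).
  apply: (is_derive_eq h).
  by rewrite /GRing.scale/= addrK.
- move=> r /[dup] r0T /andP[r0 rT].
  rewrite -(mulr_expPow a s r0) normrM gtr0_norm ?expPow_gt0//.
  have W0 := expPow_gt0 (a - 1) s r0.
  rewrite [leRHS](_ : _ = expPow (a - 1) s r *
    (2 * e * r * (a + 1 - s * r / 2))); last by ring.
  rewrite ler_pM2l// (le_trans (small _ r0T))//.
  have er : 0 <= 2 * e * r by rewrite !mulr_ge0 ?(ltW e0) ?(ltW r0).
  rewrite ler_peMr//.
  by have := low _ r0T; lra.
Unshelve. all: by end_near. Qed.

(* The homogeneous solutions are multiples of 1 / (2 expPow a s), which is
   unbounded near 0. *)
Lemma bounded_homogeneous_eq0 (D : R -> R) (B : R) :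
  (forall r, 0 < r -> `|D r| <= B) ->
  (forall r, 0 < r -> is_derive r 1 D (- (2 * a - s * r) * D r / (2 * r))) ->
  forall r, 0 < r -> D r = 0.
Proof.
move=> D_le D_df T T0.
have A0 := expPow_gt0 a s T0.
have B0 : 0 <= B by rewrite (le_trans _ (D_le _ T0)).
(* The product has derivative 0, and the bound on [D] forces its limit at [0^'+] to be 0. *)
have : `|expPow a s T * D T| <= 0.
  apply: (@norm_le_of_derive_at_right0 R (fun r => expPow a s r * D r) (cst 0)
    (cst 0) (cst 0)) => //.
  - apply/norm_cvg0P.
    apply: (@squeeze_cvgr _ _ _ _ (cst 0) (fun r => expPow a s r * B)).
    + near=> r; have r0 : 0 < r by [].
      rewrite /= normr_ge0/= normrM gtr0_norm ?expPow_gt0//.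
      by rewrite ler_pM2l ?expPow_gt0// D_le.
    + exact: cvg_cst.
    + by rewrite -[X in _ --> X](mul0r B); apply: cvgMl; exact: expPow_cvg0.
  - exact: cvg_cst.
  - move=> r /andP[r0 _].
    have rn0 : r != 0 by rewrite gt_eqF.
    have h := is_deriveM (is_derive_expPow a s r0) (D_df _ r0).
    apply: (is_derive_eq h).
    by rewrite /GRing.scale/= -(mulr_expPow a s r0); field.
  - by move=> r _; rewrite normr0.
rewrite normr_le0 mulf_eq0 gt_eqF//= => /eqP //.
Unshelve. all: by end_near. Qed.

End half_line.

(** * The law F(nu) *)

Lemma derivable_continuous (R : realType) (g : R -> R) (x : R) :
  derivable g x 1 -> {for x, continuous g}.
Proof. by move=> /derivable1_diffP/differentiable_continuous. Qed.

Lemma is_derive_integral_right (R : realType) (g : R -> R) (c r : R) : 0 < r ->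
  (forall T, lebesgue_measure.-integrable `[c, c + T] (EFin \o g)) ->
  derivable g (c + r) 1 ->
  is_derive r 1 (fun r => \int[lebesgue_measure]_(u in `[c, c + r]) g u)
    (g (c + r)).
Proof.
move=> r0 ig dg.
have [dF F'] := @continuous_FTC1_closed R g c (c + r) (c + (r + 1))
  ltac:(by rewrite ltrD2l ltrDl) (ig _) ltac:(by rewrite ltrDl)
  (derivable_continuous dg).
have h : is_derive (c + r) 1
  (fun x => \int[lebesgue_measure]_(u in `[c, x]) g u) (g (c + r)).
  by apply: (DeriveDef dF); rewrite -derive1E F'.
have hs : is_derive r 1 (fun r => c + r) (1 : R).
  have := is_deriveD (is_derive_cst c r 1) (is_derive_id r (1 : R)).
  by rewrite add0r.
by have := is_derive1_comp h hs; rewrite mulr1.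
Qed.

Lemma integral_right_cvg0 (R : realType) (g : R -> R) (c : R) :
  (forall T, lebesgue_measure.-integrable `[c, c + T] (EFin \o g)) ->
  \int[lebesgue_measure]_(u in `[c, c + r]) g u @[r --> 0^'+] --> 0.
Proof.
move=> ig; apply: cvg_at_right_filter.
have c1 : c < c + 1 by rewrite ltrDl.
have h := parameterized_integral_cvg_left c1 (ig 1).
apply: cvg_comp h.
have : {for 0, continuous (fun r : R => c + r)}.
  apply: derivable_continuous.
  by have [] := is_deriveD (is_derive_cst c (0 : R) (1 : R)) (is_derive_id (0 : R) (1 : R)).
have e : c + 0 = c by rewrite addr0.
by rewrite /prop_for /continuous_at e; exact.
Qed.

Lemma is_derive_integral_left (R : realType) (g : R -> R) (c r : R) : 0 < r ->
  (forall T, lebesgue_measure.-integrable `[c - T, c] (EFin \o g)) ->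
  derivable g (c - r) 1 ->
  is_derive r 1 (fun r => \int[lebesgue_measure]_(u in `[c - r, c]) g u)
    (g (c - r)).
Proof.
move=> r0 ig dg.
(* The moving endpoint is the lower one. For [x] near [r] the point [b] lies below [c - x], and the
   integral is a constant minus the integral from [b] to [c - x]. *)
pose b := c - (r + 1).
have [dF F'] := @continuous_FTC1_closed R g b (c - r) c
  ltac:(by rewrite ltrBlDr ltrDl) (ig _) ltac:(by rewrite /b; lra)
  (derivable_continuous dg).
have h : is_derive (c - r) 1
  (fun x => \int[lebesgue_measure]_(u in `[b, x]) g u) (g (c - r)).
  by apply: (DeriveDef dF); rewrite -derive1E F'.
have hs : is_derive r 1 (fun r => c - r) (- 1 : R).
  have := is_deriveB (is_derive_cst c r 1) (is_derive_id r (1 : R)).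
  by rewrite sub0r.
have h2 := is_deriveB (is_derive_cst
  (\int[lebesgue_measure]_(u in `[b, c]) g u) r 1)
  (@is_derive1_comp R _ (fun r => c - r) _ _ _ h hs).
rewrite sub0r mulrN1 opprK in h2.
apply: near_eq_is_derive h2.
near=> x.
rewrite !fctE /=.
have bx : b <= c - x.
  rewrite /b lerD2l lerN2 ltW//; near: x.
  by apply: lt_nbhsl; rewrite ltrDl.
have x0 : 0 < x by near: x; exact: lt_nbhsr.
rewrite Rintegral_itvB ?bnd_simp//; [|exact: ig|by rewrite lerBlDr lerDl ltW].
rewrite Rintegral_itv_obnd_cbnd//.
apply: integrableS (ig (r + 1)) => //.
by apply: subset_itv; rewrite bnd_simp.
Unshelve. all: by end_near. Qed.

Lemma integral_left_cvg0 (R : realType) (g : R -> R) (c : R) :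
  (forall T, lebesgue_measure.-integrable `[c - T, c] (EFin \o g)) ->
  \int[lebesgue_measure]_(u in `[c - r, c]) g u @[r --> 0^'+] --> 0.
Proof.
move=> ig.
have c1 : c - 1 < c by rewrite ltrBlDr ltrDl.
have h := parameterized_integral_cvg_at_left c1 (ig 1).
pose I := \int[lebesgue_measure]_(u in `[c - 1, c]) g u.
have h' : I - \int[lebesgue_measure]_(u in `[c - 1, c - r]) g u
    @[r --> 0^'+] --> 0.
  rewrite -[X in _ --> X](subrr I); apply: cvgB; first exact: cvg_cst.
  apply: cvg_comp h => //.
  move=> A [e /= e0 eA]; exists e => //= y.
  rewrite /ball_/= sub0r normrN => ye y0.
  apply: eA; last by rewrite ltrBlDr ltrDl.
  by rewrite /ball_/= opprB addrCA subrr addr0.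
apply: cvg_trans h'; apply: near_eq_cvg; near=> x.
have x0 : 0 < x by [].
have bx : c - 1 <= c - x.
  by rewrite lerD2l lerN2; near: x; apply: nbhs_right_le.
rewrite Rintegral_itvB ?bnd_simp//; last by rewrite lerBlDr lerDl ltW.
rewrite Rintegral_itv_obnd_cbnd//.
apply: integrableS (ig 1) => //.
by apply: subset_itv; rewrite bnd_simp.
Unshelve. all: by end_near. Qed.

(** The primitive [- (c - u)^a / a] bounds the integrals over [[b, c - 1/(n+1)]] by [(c - b)^a / a],
    uniformly in [n]; monotone convergence then reaches the singular endpoint [c]. *)
Lemma integrable_powR_left (R : realType) (a c b : R) : 0 < a ->
  lebesgue_measure.-integrable `[b, c[ (EFin \o (fun u : R => (c - u) `^ (a - 1))).
Proof.
move=> a0.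
have mf D : measurable_fun D (fun u : R => (c - u) `^ (a - 1)).
  apply: measurable_funTS.
  apply: (measurableT_comp (measurable_powR (a - 1))).
  exact: measurable_funB.
apply/integrableP; split.
  apply/measurable_EFinP.  exact: mf.
under eq_integral => x _ do rewrite gee0_abs ?lee_fin ?powR_ge0//.
rewrite itv_bnd_open_bigcup.
have nd : nondecreasing_seq (fun n => `[b, c - n.+1%:R^-1]%classic).
  move=> m n mn; rewrite subsetEset; apply: subset_itvl; rewrite bnd_simp.
  by rewrite lerD2l lerN2 lef_pV2 ?posrE// ler_nat.
have le_n (n : nat) : (\int[lebesgue_measure]_(x in `[b, (c - n.+1%:R^-1)%R])
   ((c - x) `^ (a - 1))%R%:E <= ((c - b) `^ a / a)%R%:E)%E.
  (* In the other case the interval has at most one point. *)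
  have [bc|cb] := ltP b (c - n.+1%:R^-1); last first.
    have sub : `[b, c - n.+1%:R^-1]%classic `<=` [set b].
      move=> x /=; rewrite in_itv/= => /andP[bx xc]; apply/eqP.
      by rewrite eq_le bx (le_trans xc).
    rewrite (integral_Sset1 b)//.
    by rewrite lee_fin divr_ge0 ?powR_ge0// ltW.
  have n0 : 0 < n.+1%:R^-1 :> R by rewrite invr_gt0.
  pose F (x : R) := - ((c - x) `^ a / a).
  have dF x : x < c -> is_derive x 1 F ((c - x) `^ (a - 1)).
    move=> xc.
    have cx : 0 < c - x by rewrite subr_gt0.
    have hs : is_derive x 1 (fun r => c - r) (- 1 : R).
      have := is_deriveB (is_derive_cst c x 1) (is_derive_id x (1 : R)).
      by rewrite sub0r.
    have h := is_deriveZ (- a^-1)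
      (@is_derive1_comp R _ (fun r => c - r) _ _ _ (is_derive1_powR a cx) hs).
    rewrite (_ : F = - a^-1 \*: ((fun r => r `^ a) \o (fun r => c - r))).
      apply: (is_derive_eq h); rewrite /GRing.scale/=; field.
      by rewrite gt_eqF.
    by apply/funext => y; rewrite /F; rewrite [RHS]mulNr mulrC.
  have xc x : x <= c - n.+1%:R^-1 -> x < c
    by move=> xn; rewrite (le_lt_trans xn)// ltrBlDr ltrDl.
  have cF x : x <= c - n.+1%:R^-1 -> {for x, continuous F}.
    by move=> /xc/dF[dFx _]; exact: derivable_continuous.
  rewrite (@continuous_FTC2 R (fun x => (c - x) `^ (a - 1)) F)//.
  - rewrite /F -EFinD lee_fin opprK addrC lerBlDr lerDl.
    by rewrite divr_ge0 ?powR_ge0// ltW.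
  - apply: derivable_within_continuous => x; rewrite in_itv/= => /andP[_ /xc xc'].
    have cx : 0 < c - x by rewrite subr_gt0.
    have hs : is_derive x 1 (fun r => c - r) (- 1 : R).
      have := is_deriveB (is_derive_cst c x 1) (is_derive_id x (1 : R)).
      by rewrite sub0r.
    by have [] := @is_derive1_comp R _ (fun r => c - r) _ _ _
      (is_derive1_powR (a - 1) cx) hs.
  - split.
    + by move=> x; rewrite in_itv/= => /andP[_ /ltW/xc/dF[]].
    + by apply: cvg_at_right_filter; apply: cF; exact: ltW.
    + by apply: cvg_at_left_filter; exact: cF.
  - move=> x; rewrite in_itv/= => /andP[_ /ltW/xc/dF[_ <-]].
    by rewrite derive1E.
have h := @ge0_nondecreasing_set_cvg_integral _ (measurableTypeR R) _
  (fun n => `[b, c - n.+1%:R^-1]%classic)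
  (fun u : R => ((c - u) `^ (a - 1))%:E) lebesgue_measure nd.
have {}h := h (fun _ => measurable_itv _).
have {}h := h (fun n => (measurable_EFinP _ _).2 (mf _)).
have {}h := h (fun _ _ _ => powR_ge0 _ _).
apply: le_lt_trans (ltry ((c - b) `^ a / a)).
by apply: (cvge_to_le h); apply: nearW.
Qed.

(** * The density, its companion [q_ nu], and expectations under the law *)

Section density.
Variables (R : realType) (nu : R).
Hypothesis nu_gt0 : 0 < nu.
Variables (d : measure_display) (Om : measurableType d) (P : probability Om R).
Variable Z : {RV P >-> R}.
Hypothesis Z_law : centered_gamma nu Z.

Local Notation mu := (@lebesgue_measure R).
Local Notation c := ((2 `^ (nu / 2) * Gamma (nu / 2))^-1).

Lemma density_right u : - nu < u -> p_ nu u = c * expPow (nu / 2 - 1) 1 (u + nu).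
Proof.
move=> u0; rewrite /p_ indicE mem_set/= ?in_itv/= ?u0// mulr1 mulrC.
by rewrite /expPow mul1r.
Qed.

Lemma density_left u : u <= - nu -> p_ nu u = 0.
Proof.
move=> u0; rewrite /p_ indicE memNset/= ?in_itv/= ?andbT ?mulr0//.
by apply/negP; rewrite -leNgt.
Qed.

Lemma q_left u : u < - nu -> q_ nu u = c * expPow (nu / 2 - 1) (- 1) (- (u + nu)).
Proof.
move=> u0; rewrite /q_ indicE mem_set/= ?in_itv/= ?u0// mulr1 mulrC.
by rewrite /expPow mulN1r opprK.
Qed.

Lemma measurable_density : measurable_fun setT (p_ nu).
Proof.
apply: measurable_funM => //; apply: measurable_funM => //.
apply: measurable_funM.
  apply: (measurableT_comp (measurable_powR _)).
  exact: measurable_funD.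
apply: measurableT_comp => //; apply: measurableT_comp => //.
by apply: measurable_funM => //; exact: measurable_funD.
Qed.

Lemma measurable_q_ : measurable_fun setT (q_ nu).
Proof.
apply: measurable_funM => //; apply: measurable_funM => //.
apply: measurable_funM.
  apply: (measurableT_comp (measurable_powR _)).
  by apply: measurableT_comp => //; exact: measurable_funD.
apply: measurableT_comp => //; apply: measurableT_comp => //.
by apply: measurable_funM => //; exact: measurable_funD.
Qed.

Lemma normalizer_ge0 : 0 <= c.
Proof.
rewrite invr_ge0 mulr_ge0 ?powR_ge0//; apply: Rintegral_ge0 => t _.
by rewrite mulr_ge0 ?powR_ge0// expR_ge0.
Qed.

Lemma density_ge0 u : 0 <= p_ nu u.
Proof.
have [u0|u0] := ltP (- nu) u; last by rewrite density_left.
by rewrite density_right// mulr_ge0 ?normalizer_ge0// ltW// expPow_gt0//; lra.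
Qed.

Lemma integral_density : (\int[mu]_u (p_ nu u)%:E = 1)%E.
Proof. by rewrite -Z_law// probability_setT. Qed.

Lemma integrable_density : mu.-integrable setT (EFin \o p_ nu).
Proof.
apply/integrableP; split.
  apply/measurable_EFinP.  exact: measurable_density.
under eq_integral => x _ do rewrite gee0_abs ?lee_fin ?density_ge0//.
by rewrite integral_density ltry.
Qed.

(* Z has a law of mass one, so that Gamma (nu / 2) cannot be the junk value 0. *)
Lemma normalizer_gt0 : 0 < c.
Proof.
rewrite lt_def normalizer_ge0 andbT; apply/eqP => c0.
have : (\int[mu]_u (p_ nu u)%:E = 0)%E.
  apply: integral0_eq => x _; congr EFin.
  have [u0|u0] := ltP (- nu) x; last by rewrite density_left.
  by rewrite density_right// c0 mul0r.
by rewrite integral_density => /eqP; rewrite onee_eq0.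
Qed.

(** The law of [Z] is dominated by Lebesgue measure, and its Radon-Nikodym derivative equals [p_ nu]
    almost everywhere because both have the same integral over every measurable set. *)
Lemma ge0_expectation_density (k : R -> R) : measurable_fun setT k ->
  (forall u, 0 <= k u) ->
  (\int[P]_w (k (Z w))%:E = \int[mu]_u (k u * p_ nu u)%:E)%E.
Proof.
move=> mk k0.
have mZ : measurable_fun [set: Om] (Z : Om -> measurableTypeR R).
  exact: (measurable_funP Z).
(* The same map, retyped so that its distribution and [mu] are measures on the same measurable
   type. *)
pose Z' : {RV P >-> measurableTypeR R} :=
  HB.pack (Z : Om -> measurableTypeR R) (isMeasurableFun.Build _ _ _ _ _ mZ).
have D_law A : measurable A ->
    distribution P Z' A = (\int[mu]_(x in A) (p_ nu x)%:E)%E.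
  exact: Z_law.
have domD : distribution P Z' `<< mu.
  apply/null_content_dominatesP => A mA A0; rewrite D_law//.
  apply: null_set_integral => //=.
  apply: measurable_funTS; apply/measurable_EFinP; exact: measurable_density.
have mk' : measurable_fun [set: measurableTypeR R] (EFin \o k).
  by apply/measurable_EFinP; exact: mk.
rewrite -[LHS](@ge0_integral_distribution _ _ _ _ _ P Z' (EFin \o k))//.
rewrite -(Radon_Nikodym_SigmaFinite.change_of_variables domD)//.
apply: ae_eq_integral => //.
- apply: emeasurable_funM => //.
  exact: measurable_int (Radon_Nikodym_SigmaFinite.f_integrable domD).
- by apply/measurable_EFinP/measurable_funM => //; exact: measurable_density.
- under [X in ae_eq _ _ _ X]eq_fun do rewrite EFinM.
  apply: ae_eqe_mul2l; apply: integral_ae_eq => //.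
  + exact: (Radon_Nikodym_SigmaFinite.f_integrable domD).
  + by apply/measurable_EFinP; exact: measurable_density.
  + move=> E _ mE; rewrite -(Radon_Nikodym_SigmaFinite.f_integral domD mE).
    exact: D_law.
Qed.

(** Measurability of [k] is asked separately: the product with [p_ nu] forgets [k] where the density
    vanishes, whereas [k \o Z] must be measurable. *)
Definition density_integrable (k : R -> R) : Prop :=
  measurable_fun setT k /\ mu.-integrable setT (EFin \o (fun u => k u * p_ nu u)).

Lemma integrable_comp_law (k : R -> R) : density_integrable k ->
  P.-integrable setT (EFin \o (k \o Z)).
Proof.
move=> [mk /integrableP[_ ik]].
apply/integrableP; split.
  by apply/measurable_EFinP; apply: measurableT_comp => //; exact: measurable_funP.
have mk' : measurable_fun setT (fun u => `|k u|) by exact: measurableT_comp.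
have := @ge0_expectation_density _ mk' (fun u => normr_ge0 _) => /= ->.
rewrite (_ : (\int[mu]_u _)%E =
    (\int[mu]_u `|(EFin \o (fun u => k u * p_ nu u)%R) u|)%E) //.
by apply: eq_integral => u _ /=; rewrite normrM (ger0_norm (density_ge0 u)).
Qed.

(** The nonnegative case is applied to the positive and negative parts of [k]; these commute with
    multiplication by the nonnegative density. *)
Lemma expectation_density (k : R -> R) : density_integrable k ->
  fine ('E_P[k \o Z])%E = \int[mu]_u (k u * p_ nu u).
Proof.
move=> ik; have [mk ikp] := ik; rewrite unlock /Rintegral; congr fine.
rewrite [LHS]integralE [RHS]integralE; congr (_ - _)%E.
- have mk' : measurable_fun setT (fun u => Num.max (k u) 0) by exact: measurable_maxr.
  have h := @ge0_expectation_density _ mk'.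
  transitivity (\int[P]_w (Num.max (k (Z w)) 0)%:E)%E.
    by apply: eq_integral => w _; rewrite funeposE /= EFin_max.
  rewrite h => [|u]; last by rewrite le_max lexx orbT.
  apply: eq_integral => u _; rewrite funeposE /= -EFin_max.
  by rewrite maxr_pMl ?density_ge0// mul0r.
- have mk' : measurable_fun setT (fun u => Num.max (- k u) 0).
    by apply: measurable_maxr => //; exact: measurableT_comp.
  have h := @ge0_expectation_density _ mk'.
  transitivity (\int[P]_w (Num.max (- k (Z w)) 0)%:E)%E.
    by apply: eq_integral => w _; rewrite funenegE /= EFin_max.
  rewrite h => [|u]; last by rewrite le_max lexx orbT.
  apply: eq_integral => u _; rewrite funenegE /= -EFin_max.
  by rewrite maxr_pMl ?density_ge0// mul0r mulNr.
Qed.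

Lemma derivable_density u : - nu < u -> derivable (p_ nu) u 1.
Proof.
move=> u0.
have h0 : is_derive u 1 (fun x => x + nu) (1 : R).
  have := is_deriveD (is_derive_id u (1 : R)) (is_derive_cst nu u 1).
  by rewrite addr0.
have un0 : 0 < u + nu by lra.
have [h _] := is_deriveZ c (@is_derive1_comp R _ (fun x => x + nu) _ _ _
   (is_derive_expPow (nu / 2 - 1) 1 un0) h0).
apply: near_eq_derivable h.
near=> x; rewrite density_right//.
by near: x; exact: lt_nbhsr.
Unshelve. all: by end_near. Qed.

Lemma derivable_q_ u : u < - nu -> derivable (q_ nu) u 1.
Proof.
move=> u0.
have h0 : is_derive u 1 (fun x => - (x + nu)) (- 1 : R).
  have := is_deriveN (is_deriveD (is_derive_id u (1 : R)) (is_derive_cst nu u 1)).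
  by rewrite addr0.
have un0 : 0 < - (u + nu) by lra.
have [h _] := is_deriveZ c (@is_derive1_comp R _ (fun x => - (x + nu)) _ _ _
   (is_derive_expPow (nu / 2 - 1) (- 1) un0) h0).
apply: near_eq_derivable h.
near=> x; rewrite q_left//.
by near: x; exact: lt_nbhsl.
Unshelve. all: by end_near. Qed.

Lemma integrable_density_itv (H : R -> R) (T : R) : continuous H ->
  mu.-integrable `[- nu, - nu + T] (EFin \o (fun u => p_ nu u * H u)).
Proof.
move=> cH.
have mH : measurable_fun setT H by exact: continuous_measurable_fun.
have bH : [bounded H x | x in `[- nu, - nu + T]].
  have cpt : compact (H @` `[- nu, - nu + T]%classic).
    apply: continuous_compact; last exact: segment_compact.
    exact: continuous_subspaceT.
  have [M [Mr hM]] := compact_bounded cpt.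
  by exists M; split => // x Mx u hu; apply: hM => //; exists u.
have := @integrableMl _ _ _ mu `[- nu, - nu + T]%classic (measurable_itv _)
  (EFin \o p_ nu) H.
apply => //; first exact: integrableS integrable_density.
exact: measurable_funTS.
Qed.

Lemma q_ge0 u : 0 <= q_ nu u.
Proof.
have [u0|u0] := ltP u (- nu).
  by rewrite q_left// mulr_ge0 ?normalizer_ge0// ltW// expPow_gt0//; lra.
rewrite /q_ indicE memNset/= ?in_itv/= ?mulr0//.
by apply/negP; rewrite -leNgt.
Qed.

(** On [[b, - nu[] the exponential factor is largest at [b], so [q_ nu] is dominated by a multiple
    of the power [(- nu - u)^(nu/2 - 1)]. The endpoint [- nu] is a null set. *)
Lemma integrable_q_ (b : R) : mu.-integrable `[b, - nu] (EFin \o q_ nu).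
Proof.
have mq D : measurable_fun D (EFin \o q_ nu : measurableTypeR R -> \bar R).
  by apply: measurable_funTS; apply/measurable_EFinP; exact: measurable_q_.
have : mu.-integrable `[b, - nu[ (EFin \o q_ nu).
  have a0 : 0 < nu / 2 by rewrite divr_gt0.
  have ip := integrable_powR_left (- nu) b a0.
  have h := integrableZl _ (c * expR (- ((b + nu) / 2))) ip.
  apply: le_integrable (h _) => //= u; rewrite in_itv/= => /andP[bu un].
  rewrite lee_fin !ger0_norm ?q_ge0 ?mulr_ge0 ?powR_ge0 ?expR_ge0 ?normalizer_ge0//.
  rewrite q_left// -mulrA ler_wpM2l ?normalizer_ge0// /expPow mulrC opprD addrC.
  by rewrite ler_wpM2r ?powR_ge0// ler_expR; lra.
move=> /integrableP[_ h]; apply/integrableP; split => //.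
rewrite -integral_itv_bndo_bndc//.
by apply: measurableT_comp => //; exact: mq.
Qed.

Lemma integrable_q_itv (H : R -> R) (T : R) : continuous H ->
  mu.-integrable `[- nu - T, - nu] (EFin \o (fun u => q_ nu u * H u)).
Proof.
move=> cH.
have mH : measurable_fun setT H by exact: continuous_measurable_fun.
have bH : [bounded H x | x in `[- nu - T, - nu]].
  have cpt : compact (H @` `[- nu - T, - nu]%classic).
    apply: continuous_compact; last exact: segment_compact.
    exact: continuous_subspaceT.
  have [M [Mr hM]] := compact_bounded cpt.
  by exists M; split => // x Mx u hu; apply: hM => //; exists u.
have := @integrableMl _ _ _ mu `[- nu - T, - nu]%classic (measurable_itv _)
  (EFin \o q_ nu) H.
apply => //; first exact: integrable_q_.
exact: measurable_funTS.
Qed.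

(** As functions of [T], both sides tend to 0 at [0^'+] and have the same derivative; the comparison
    lemma in both directions gives equality. *)
Lemma integral_id_density (T : R) : 0 < T ->
  \int[mu]_(u in `[- nu, - nu + T]) (p_ nu u * u) =
  - (2 * c * expPow (nu / 2) 1 T).
Proof.
move=> T0.
have a0 : 0 < nu / 2 by rewrite divr_gt0.
have ip r := @integrable_density_itv id r (fun _ => cvg_id).
have df r : 0 < r <= T -> is_derive r 1
    (fun r => \int[mu]_(u in `[- nu, - nu + r]) (p_ nu u * u))
    (c * expPow (nu / 2 - 1) 1 r * (r - nu)).
  move=> /andP[r0 _].
  have rn : - nu < - nu + r by rewrite ltrDl.
  have dp : derivable (fun u => p_ nu u * u) (- nu + r) 1.
    by apply: derivableM; [exact: derivable_density|exact: derivable_id].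
  apply: is_derive_eq (is_derive_integral_right r0 ip dp) _.
  by rewrite density_right// addrAC addNr add0r (addrC _ r).
have dg r : 0 < r <= T -> is_derive r 1
    (fun r => - (2 * c) * expPow (nu / 2) 1 r)
    (c * expPow (nu / 2 - 1) 1 r * (r - nu)).
  move=> /andP[r0 _].
  apply: is_derive_eq (is_deriveZ _ (is_derive_expPow (nu / 2) 1 r0)) _.
  by rewrite /GRing.scale/=; move: c => C; field.
have g0 : - (2 * c) * expPow (nu / 2) 1 r @[r --> 0^'+] --> 0.
  by rewrite -[X in _ --> X](mulr0 (- (2 * c))); apply: cvgMr; exact: expPow_cvg0.
have f0 := integral_right_cvg0 ip.
rewrite -mulNr; apply/eqP; rewrite eq_le; apply/andP; split.
- exact: (le_of_derive_at_right0 T0 f0 g0 df dg).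
- exact: (le_of_derive_at_right0 T0 g0 f0 dg df).
Qed.

(** Shifting by [nu] makes the integrand nonnegative, so monotone convergence applies along
    [[- nu, - nu + n]]. There [integral_id_density] makes the integral of [u] nonpositive, and the
    mass is at most 1. This yields both a finite first moment and a nonpositive mean. *)
Lemma integral_shift_density_le :
  (\int[mu]_u ((u + nu) * p_ nu u)%:E <= nu%:E)%E.
Proof.
pose f (u : measurableTypeR R) := ((u + nu) * p_ nu u)%:E.
have f0 u : (0 <= f u)%E.
  rewrite lee_fin; have [u0|u0] := ltP (- nu) u; last by rewrite density_left ?mulr0.
  by rewrite mulr_ge0 ?density_ge0//; lra.
have mf D : measurable_fun D f.
  apply: measurable_funTS; apply/measurable_EFinP; apply: measurable_funM.
    exact: measurable_funD.
  exact: measurable_density.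
rewrite (_ : (\int[mu]_u _)%E = (\int[mu]_(u in `[(- nu)%R, +oo[) f u)%E); last first.
  rewrite [RHS]integral_mkcond; apply: eq_integral => u _.
  rewrite patchE; case: ifPn => //; rewrite notin_setE/= in_itv/= andbT.
  by move=> /negP; rewrite -ltNge => /ltW u0; rewrite density_left ?mulr0.
rewrite itv_bndy_bigcup_BRight.
have nd : nondecreasing_seq (fun n => `[- nu, - nu + n%:R]%classic).
  move=> m n mn; rewrite subsetEset; apply: subset_itvl; rewrite bnd_simp.
  by rewrite lerD2l ler_nat.
have h := @ge0_nondecreasing_set_cvg_integral _ (measurableTypeR R) _
  (fun n => `[- nu, - nu + n%:R]%classic) f mu nd.
have {}h := h (fun _ => measurable_itv _) (fun _ => mf _) (fun _ _ _ => f0 _).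
apply: (cvge_to_le h); apply: nearW => n.
have ip1 : mu.-integrable `[- nu, - nu + n%:R] (EFin \o p_ nu).
  exact: integrableS integrable_density.
have ipu := @integrable_density_itv id n%:R (fun _ => cvg_id).
have ipn : mu.-integrable `[- nu, - nu + n%:R] (EFin \o (fun u => p_ nu u * nu)).
  by apply: (@integrable_density_itv (cst nu)) => x; exact: cvg_cst.
have ipun : mu.-integrable `[- nu, - nu + n%:R]
    (EFin \o (fun u => p_ nu u * u + p_ nu u * nu)).
  have ipD := integrableD _ ipu ipn.
  by apply: eq_integrable (ipD _).
rewrite (_ : (\int[mu]_(u in _) f u)%E =
  (\int[mu]_(u in `[- nu, - nu + n%:R]) (p_ nu u * u + p_ nu u * nu))%R%:E); last first.
  rewrite /Rintegral fineK.
    by apply: eq_integral => u _; rewrite /f mulrC mulrDr.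
  by apply: (integrable_fin_num _ ipun).
rewrite RintegralD// RintegralZr// lee_fin.
have p1 : \int[mu]_(u in `[- nu, - nu + n%:R]) p_ nu u <= 1.
  rewrite -lee_fin /Rintegral fineK; last exact: integrable_fin_num.
  rewrite -integral_density; apply: ge0_subset_integral => //.
  - by apply/measurable_EFinP; exact: measurable_density.
  - by move=> u _; rewrite lee_fin density_ge0.
(* [integral_id_density] asks for a positive length; for [n = 0] the interval is a point. *)
have [->|n0] := posnP n.
  rewrite addr0 set_itv1 !Rintegral_set1 add0r mul0r; exact: ltW.
rewrite integral_id_density ?ltr0n//.
have A0 : 0 < 2 * c * expPow (nu / 2) 1 n%:R.
  by apply: mulr_gt0; [apply: mulr_gt0 => //; exact: normalizer_gt0|rewrite expPow_gt0 ?ltr0n].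
rewrite -lerBrDl opprK (@le_trans _ _ nu)//; first by rewrite ger_pMl.
by rewrite lerDl ltW.
Qed.

End density.

(** * Test functions against F(nu) *)

Lemma is_derive_slopeP (R : realType) (f : R -> R) (c l : R) :
  is_derive c 1 f l <->
  forall e, 0 < e -> \forall h \near 0, `|f (c + h) - f c - l * h| <= e * `|h|.
Proof.
have E h : h != 0 -> `|l - h^-1 *: (f (h *: (1 : R) + c) - f c)| =
    `|f (c + h) - f c - l * h| / `|h|.
  move=> h0; rewrite -normf_div distrC /GRing.scale/= mulr1 (addrC h).
  by congr `|_|; field.
split=> [[df fl] e e0|slope].
  have /cvgrPdist_le/(_ e e0) : h^-1 *: (f (h *: (1 : R) + c) - f c) @[h --> 0^'] --> l.
    by rewrite -fl; exact: df.
  move=> [d /= d0 hd]; exists d => //= h hd'.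
  have [->|h0] := eqVneq h 0; first by rewrite addr0 subrr mulr0 subr0 normr0 mulr0.
  have := hd h hd' h0; rewrite E// ler_pdivrMr//.
  by rewrite normr_gt0.
have cv : h^-1 *: (f (h *: (1 : R) + c) - f c) @[h --> 0^'] --> l.
  apply/cvgrPdist_le => e e0.
  have [d /= d0 hd] := slope e e0.
  exists d => //= h hd' h0; rewrite E// ler_pdivrMr ?normr_gt0//.
  exact: hd.
apply: DeriveDef; first by apply/cvg_ex; exists l.
exact: cvg_lim.
Qed.

(** Glues one-sided expansions with a common slope, as needed at [- nu], where the two sides and the
    point itself have separate formulas. *)
Lemma is_derive_of_sides (R : realType) (f : R -> R) (c l : R) :
  (forall e, 0 < e -> \forall h \near 0^'+, `|f (c + h) - f c - l * h| <= e * h) ->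
  (forall e, 0 < e -> \forall h \near 0^'+, `|f (c - h) - f c + l * h| <= e * h) ->
  is_derive c 1 f l.
Proof.
move=> fr fl; apply/is_derive_slopeP => e e0.
have [d1 /= d10 h1] := fr e e0.
have [d2 /= d20 h2] := fl e e0.
exists (Num.min d1 d2); first by rewrite /= lt_min d10.
move=> h /=; rewrite sub0r normrN lt_min => /andP[hd1 hd2].
have [h0|h0|->] := ltgtP h 0.
- rewrite ltr0_norm// in hd1 hd2 *.
  have := h2 (- h); rewrite /ball_/= sub0r !opprK (ltr0_norm h0) mulrN.
  by move=> /(_ hd2); apply; rewrite oppr_gt0.
- rewrite gtr0_norm// in hd1 hd2 *.
  by have := h1 h; rewrite /ball_/= sub0r normrN gtr0_norm// => /(_ hd1 h0).
- by rewrite addr0 subrr mulr0 subr0 normr0 mulr0.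
Qed.

Lemma lipschitz_of_derive (R : realType) (k dk : R -> R) (L : R) :
  (forall u : R, is_derive u 1 k (dk u)) -> (forall u, `|dk u| <= L) ->
  forall u v, `|k u - k v| <= L * `|u - v|.
Proof.
move=> k_df k_le.
suff le u v : u <= v -> `|k u - k v| <= L * `|u - v|.
  move=> u v; have [/le//|/ltW/le] := leP u v.
  by rewrite distrC (distrC v).
move=> uv; have [|c _] := @MVT_segment R k dk u v uv.
  by apply: derivable_within_continuous => x _; have [] := k_df x.
rewrite distrC (distrC u) => ->; rewrite normrM.
by rewrite ler_wpM2r.
Qed.

(** * Moments of the law and Lipschitz test functions *)

Section moments.
Variables (R : realType) (nu : R).
Hypothesis nu_gt0 : 0 < nu.
Variables (d : measure_display) (Om : measurableType d) (P : probability Om R).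
Variable Z : {RV P >-> R}.
Hypothesis Z_law : centered_gamma nu Z.

Local Notation mu := (@lebesgue_measure R).

Lemma integrable_shift_density :
  mu.-integrable setT (EFin \o (fun u => (u + nu) * p_ nu u)).
Proof.
apply/integrableP; split.
  apply/measurable_EFinP; apply: measurable_funM; last exact: measurable_density.
  exact: measurable_funD.
apply: le_lt_trans (ltry nu).
apply: le_trans (integral_shift_density_le nu_gt0 Z_law).
rewrite (_ : (\int[mu]_x _)%E = (\int[mu]_u ((u + nu) * p_ nu u)%:E)%E) //.
apply: eq_integral => u _ /=; rewrite ger0_norm//.
have [u0|u0] := ltP (- nu) u; last by rewrite density_left ?mulr0.
by rewrite mulr_ge0 ?density_ge0//; lra.
Qed.

Lemma density_integrable_linear (k : R -> R) (A B : R) : measurable_fun setT k ->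
  (forall u, `|k u| <= A + B * `|u|) -> density_integrable nu k.
Proof.
move=> mk k_le; split => //.
have A0 : 0 <= A.
  by have := le_trans (normr_ge0 _) (k_le 0); rewrite normr0 mulr0 addr0.
(* On the support, [|u| <= (u + nu) + nu], which reduces the domination to [(u + nu) * p_ nu u] and
   [p_ nu u]. The sign of [B] is free, hence [|B|]. *)
have key (u : R) : `|k u * p_ nu u| <=
    `| `|B| * ((u + nu) * p_ nu u) + (A + `|B| * nu) * p_ nu u|.
  rewrite normrM (ger0_norm (density_ge0 _ u)).
  have [u0|u0] := ltP (- nu) u; last by rewrite density_left ?mulr0.
  rewrite (mulrA `|B|) -mulrDl (le_trans _ (ler_norm _))// ler_wpM2r ?density_ge0//.
  rewrite (le_trans (k_le u))//.
  have un : `|u| <= u + nu + nu by have := nu_gt0; rewrite ler_norml; lra.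
  have : B * `|u| <= `|B| * `|u| by rewrite ler_wpM2r// ler_norm.
  have := ler_wpM2l (normr_ge0 B) un.
  by rewrite !mulrDr; lra.
have i1 := integrableZl measurableT (`|B|) integrable_shift_density.
have i2 := integrableZl measurableT (A + `|B| * nu) (integrable_density Z_law).
have i3 := integrableD measurableT i1 i2.
apply: le_integrable i3 => //=.
  apply/measurable_EFinP; apply: measurable_funM => //; exact: measurable_density.
by move=> u _; rewrite lee_fin; exact: key.
Qed.

Lemma density_integrable_id : density_integrable nu id.
Proof.
by apply: (@density_integrable_linear _ 0 1) => // u; rewrite mul1r add0r.
Qed.

Lemma density_integrable_cst (A : R) : density_integrable nu (cst A).
Proof. by apply: (@density_integrable_linear _ `|A| 0) => // u; rewrite mul0r addr0. Qed.

Lemma Rintegral_density : \int[mu]_u p_ nu u = 1.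
Proof. by rewrite /Rintegral (integral_density Z_law). Qed.

Lemma Rintegral_density_cst (A : R) : \int[mu]_u (A * p_ nu u) = A.
Proof.
rewrite RintegralZl//; first by rewrite Rintegral_density mulr1.
exact: integrable_density Z_law.
Qed.

Lemma Rintegral_densityD (k l : R -> R) : density_integrable nu k -> density_integrable nu l ->
  \int[mu]_u ((k u + l u) * p_ nu u) =
  \int[mu]_u (k u * p_ nu u) + \int[mu]_u (l u * p_ nu u).
Proof.
move=> [_ ik] [_ il]; rewrite -RintegralD//.
by apply: eq_Rintegral => u _; rewrite mulrDl.
Qed.

Lemma Rintegral_densityZ (A : R) (k : R -> R) : density_integrable nu k ->
  \int[mu]_u ((A * k u) * p_ nu u) = A * \int[mu]_u (k u * p_ nu u).
Proof.
move=> [_ ik]; rewrite -RintegralZl//.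
by apply: eq_Rintegral => u _; rewrite mulrA.
Qed.

Lemma Rintegral_id_density_le0 : \int[mu]_u (u * p_ nu u) <= 0.
Proof.
have := integral_shift_density_le nu_gt0 Z_law.
rewrite -[X in (X <= _)%E]fineK; last first.
  exact: (integrable_fin_num measurableT integrable_shift_density).
rewrite lee_fin -[X in X <= _]/(\int[mu]_u ((u + nu) * p_ nu u)).
rewrite (Rintegral_densityD density_integrable_id (density_integrable_cst nu)).
rewrite Rintegral_density_cst.
by rewrite gerDr.
Qed.

Lemma le_Rintegral_density (k l : R -> R) :
  density_integrable nu k -> density_integrable nu l ->
  (forall u, - nu < u -> k u <= l u) ->
  \int[mu]_u (k u * p_ nu u) <= \int[mu]_u (l u * p_ nu u).
Proof.
move=> [_ ik] [_ il] kl; apply: le_Rintegral => // u _.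
have [u0|u0] := ltP (- nu) u; last by rewrite !density_left ?mulr0.
by rewrite ler_wpM2r ?density_ge0 ?kl.
Qed.

(* A nondecreasing function whose mean is nonpositive is first nonpositive, then
   nonnegative. *)
Lemma partial_integral_le0 (K : R -> R) (x : R) : density_integrable nu K ->
  {homo K : u v / u <= v} -> \int[mu]_u (K u * p_ nu u) <= 0 ->
  \int[mu]_(u in `[- nu, x]) (K u * p_ nu u) <= 0.
Proof.
move=> [mK iK] ndK K0.
have [Kx|Kx] := leP (K x) 0.
  rewrite -oppr_ge0 -[leRHS]mulN1r -RintegralZl//; last first.
    exact: integrableS iK.
  apply: Rintegral_ge0 => u /=; rewrite in_itv/= => /andP[_ ux].
  rewrite mulN1r -mulNr mulr_ge0 ?density_ge0// oppr_ge0.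
  exact: le_trans (ndK _ _ ux) Kx.
(* Here [K] is positive beyond [x], so cutting the full integral at [x] can only lower it. *)
apply: le_trans K0; rewrite Rintegral_mkcond.
apply: le_Rintegral => //.
  rewrite -restrict_EFin; apply/integrable_restrict => //.
  by rewrite setTI; exact: integrableS iK.
move=> u _; rewrite patchE; case: ifPn => //.
rewrite notin_setE/= in_itv/= => /negP.
rewrite negb_and -!ltNge => /orP[/ltW u0|xu]; first by rewrite density_left ?mulr0.
by rewrite mulr_ge0 ?density_ge0// (le_trans (ltW Kx))// ndK// ltW.
Qed.

Section test_function.
Variables (k dk : R -> R) (L : R).
Hypothesis k_df : forall u : R, is_derive u 1 k (dk u).
Hypothesis k_le : forall u, `|dk u| <= L.

Let m := \int[mu]_u (k u * p_ nu u).

Let L0 : 0 <= L. Proof. exact: le_trans (k_le 0). Qed.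

Lemma continuous_of_derive : continuous k.
Proof. by move=> u; apply: derivable_continuous; have [] := k_df u. Qed.

Lemma density_integrable_lipschitz : density_integrable nu k.
Proof.
apply: (@density_integrable_linear _ `|k 0| L).
  exact: continuous_measurable_fun continuous_of_derive.
move=> u; have := lipschitz_of_derive k_df k_le u 0; rewrite subr0.
by have := ler_normD (k 0) (k u - k 0); rewrite subrKC; lra.
Qed.

(** [k x - m] is the mean of [k x - k u], hence at most [L] times the mean of [|x - u|] in absolute
    value. Bounding [|x - u|] by [A + u] on the support leaves [A], because the mean of [u] is
    nonpositive. *)
Lemma centered_norm_le (A x : R) :
  (forall u, - nu < u -> `|x - u| <= A + u) -> `|k x - m| <= L * A.
Proof.
move=> A_le.
have i1 : density_integrable nu (fun u => L * (A + u)).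
  apply: (@density_integrable_linear _ (L * `|A|) L) => [|u].
    by apply: measurable_funM => //; exact: measurable_funD.
  by rewrite normrM ger0_norm// -mulrDr ler_wpM2l// ler_normD.
have ik := density_integrable_lipschitz.
have iN (s : R) : density_integrable nu (fun u => s * k u).
  case: ik => mk ik; split; first exact: measurable_funM.
  have h := integrableZl measurableT s ik.
  by apply: eq_integrable h => // u _ /=; rewrite -EFinM mulrA.
have I1 : \int[mu]_u (L * (A + u) * p_ nu u) <= L * A.
  have iA : density_integrable nu (fun u => A + u).
    apply: (@density_integrable_linear _ `|A| 1) => [|u].
      exact: measurable_funD.
    by rewrite mul1r ler_normD.
  rewrite (Rintegral_densityZ L iA) ler_wpM2l//.
  rewrite (Rintegral_densityD (density_integrable_cst A) density_integrable_id).
  rewrite Rintegral_density_cst.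
  by have := Rintegral_id_density_le0; lra.
(* The sign [s] treats both halves of the absolute value at once. *)
have key (s : R) : `|s| = 1 -> s * (k x - m) <= L * A.
  move=> s1; apply: le_trans I1.
  have -> : s * (k x - m) = \int[mu]_u ((s * k x + - s * k u) * p_ nu u).
    rewrite (Rintegral_densityD (density_integrable_cst (s * k x)) (iN (- s))).
    rewrite Rintegral_density_cst.
    by rewrite (Rintegral_densityZ _ ik) mulrBr mulNr.
  apply: le_Rintegral_density => //.
    case: (density_integrable_cst (s * k x)) => m1 j1; case: (iN (- s)) => m2 j2.
    split; first exact: measurable_funD.
    have h := integrableD measurableT j1 j2.
    by apply: eq_integrable h => // u _ /=; rewrite -EFinD mulrDl.
  move=> u u0; rewrite mulNr -mulrBr (le_trans (ler_norm _))// normrM s1 mul1r.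
  rewrite (le_trans (lipschitz_of_derive k_df k_le _ _))// ler_wpM2l//.
  exact: A_le.
rewrite ler_norml; apply/andP; split.
  have := key (- 1); rewrite normrN1 => /(_ erefl); rewrite mulN1r; lra.
by have := key 1; rewrite normr1 mul1r; exact.
Qed.

Local Notation c := ((2 `^ (nu / 2) * Gamma (nu / 2))^-1).

Lemma partial_integral_norm_le (r : R) : 0 < r ->
  `|\int[mu]_(u in `[- nu, - nu + r]) (p_ nu u * (k u - m))|
    <= L * (2 * c * expPow (nu / 2) 1 r).
Proof.
move=> r0.
have ck := continuous_of_derive.
have cH : continuous (fun u => k u - m).
  by move=> u; apply: cvgB; [exact: ck|exact: cvg_cst].
have iid := integrable_density_itv Z_law r (fun u => @cvg_id _ (nbhs u)).
have iH := integrable_density_itv Z_law r cH.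
have ik := density_integrable_lipschitz.
have key (s : R) : `|s| = 1 ->
    s * \int[mu]_(u in `[- nu, - nu + r]) (p_ nu u * (k u - m)) <=
    L * (2 * c * expPow (nu / 2) 1 r).
  move=> s1.
  (* Nondecreasing because [k] is [L]-Lipschitz, and of nonpositive mean because [k - m] has mean 0.
     The [L u] part of its partial integral is [integral_id_density]. *)
  pose K u := L * u + s * (k u - m).
  have iH' : density_integrable nu (fun u => s * (k u - m)).
    (* The constants come from [centered_norm_le] with [A = |u| + 2 nu], since [|v| <= v + 2 nu] on
       the support. *)
    apply: (@density_integrable_linear _ (L * 2 * nu) L).
      apply: measurable_funM => //; exact: continuous_measurable_fun.
    move=> u; rewrite normrM s1 mul1r.
    rewrite (le_trans (@centered_norm_le (`|u| + 2 * nu) u _))//; last first.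
      by rewrite mulrDr; lra.
    move=> v v0; rewrite (le_trans (ler_normB _ _))//.
    suff : `|v| <= v + 2 * nu by lra.
    by have := nu_gt0; rewrite ler_norml; lra.
  have iL : density_integrable nu (fun u => L * u).
    apply: (@density_integrable_linear _ 0 L) => [|u]; first exact: measurable_funM.
    by rewrite normrM ger0_norm// add0r.
  have iK : density_integrable nu K.
    case: iL => m1 j1; case: iH' => m2 j2.
    split; first exact: measurable_funD.
    have h := integrableD measurableT j1 j2.
    by apply: eq_integrable h => // u _ /=; rewrite -EFinD mulrDl.
  have ndK : {homo K : u v / u <= v}.
    move=> u v uv; rewrite /K -subr_ge0.
    have := lipschitz_of_derive k_df k_le v u.
    rewrite (ger0_norm (_ : 0 <= v - u)) ?subr_ge0// => h.
    have : - (s * (k v - k u)) <= L * (v - u).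
      by rewrite (le_trans (ler_norm _))// normrN normrM s1 mul1r.
    by rewrite !mulrBr; lra.
  have K0 : \int[mu]_u (K u * p_ nu u) <= 0.
    rewrite (Rintegral_densityD iL iH') (Rintegral_densityZ _ density_integrable_id).
    have -> : \int[mu]_u (s * (k u - m) * p_ nu u) = 0.
      have iB : density_integrable nu (fun u => k u + (- m)).
        split; first exact: continuous_measurable_fun.
        case: ik => m1 j1; case: (density_integrable_cst (- m)) => m2 j2.
        have h := integrableD measurableT j1 j2.
        by apply: eq_integrable h => // u _ /=; rewrite -EFinD mulrDl.
      rewrite (Rintegral_densityZ _ iB) (Rintegral_densityD ik (density_integrable_cst (- m))).
      by rewrite Rintegral_density_cst -/m subrr mulr0.
    by rewrite addr0 mulr_ge0_le0// Rintegral_id_density_le0.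
  have := partial_integral_le0 (- nu + r) iK ndK K0.
  rewrite (_ : \int[mu]_(u in _) (K u * p_ nu u) =
    L * \int[mu]_(u in `[- nu, - nu + r]) (p_ nu u * u) +
    s * \int[mu]_(u in `[- nu, - nu + r]) (p_ nu u * (k u - m))).
    rewrite (integral_id_density nu_gt0 Z_law r0).
    by move: (2 * c * _) => X; rewrite mulrN; lra.
  rewrite -!RintegralZl// -RintegralD//.
  - by apply: eq_Rintegral => u _; rewrite /K; ring.
  - have h := integrableZl _ L iid; exact: eq_integrable (h _).
  - have h := integrableZl _ s iH; exact: eq_integrable (h _).
rewrite ler_norml; apply/andP; split.
  have := key (- 1); rewrite normrN1 => /(_ erefl); rewrite mulN1r; lra.
by have := key 1; rewrite normr1 mul1r; exact.
Qed.

End test_function.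
End moments.

(** * The solution in one variable *)

(** [stein_solution] at a fixed [y], with [H] in place of the centered test function. *)
Definition line_solution {R : realType} (nu : R) (H : R -> R) (x : R) : R :=
    (\int[lebesgue_measure]_(u in `[- nu, x])
       (p_ nu u / (2 * (x + nu) * p_ nu x) * H u))
      * \1_(`]- nu, +oo[) x
  - (\int[lebesgue_measure]_(u in `[x, - nu])
       (q_ nu u / (2 * (x + nu) * q_ nu x) * H u))
      * \1_(`]-oo, - nu[) x
  + H (- nu) / nu * \1_([set - nu]) x.

Section solution.
Variables (R : realType) (nu : R).
Hypothesis nu_gt0 : 0 < nu.
Variables (d : measure_display) (Om : measurableType d) (P : probability Om R).
Variable Z : {RV P >-> R}.
Hypothesis Z_law : centered_gamma nu Z.

Local Notation mu := (@lebesgue_measure R).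
Local Notation c := ((2 `^ (nu / 2) * Gamma (nu / 2))^-1).
Local Notation a := (nu / 2).

Let a_gt0 : 0 < a. Proof. by rewrite divr_gt0. Qed.
Let a2 : 2 * a = nu. Proof. by field. Qed.
Let cpos : 0 < c. Proof. exact: normalizer_gt0 Z_law. Qed.

Variables (k dk : R -> R) (L : R).
Hypothesis k_df : forall u : R, is_derive u 1 k (dk u).
Hypothesis k_le : forall u : R, `|dk u| <= L.

Let m := \int[mu]_u (k u * p_ nu u).
Let H u := k u - m.
Let F := line_solution nu H.
Let L0 : 0 <= L. Proof. exact: le_trans (k_le 0). Qed.

Let cH : continuous H.
Proof.
by move=> u; apply: cvgB; [exact: continuous_of_derive k_df _|exact: cvg_cst].
Qed.

Let H_df (u : R) : is_derive u 1 H (dk u).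
Proof.
have := is_deriveB (k_df u) (is_derive_cst m u 1).
by rewrite subr0.
Qed.

(** Removing the normalizing constant makes [Jr] and [Jl] instances of [J] in the half-line section,
    with [K r] equal to [H (- nu + r)], [s = 1], and to [H (- nu - r)], [s = - 1]. *)
Let Jr (r : R) := c^-1 * \int[mu]_(u in `[- nu, - nu + r]) (p_ nu u * H u).
Let Jl (r : R) := c^-1 * \int[mu]_(u in `[- nu - r, - nu]) (q_ nu u * H u).

Lemma line_solution_base : F (- nu) = H (- nu) / nu.
Proof.
rewrite /F /line_solution !indicE memNset/= ?in_itv/= ?ltxx//.
by rewrite memNset/= ?in_itv/= ?ltxx// mem_set//= !mulr0 subr0 add0r mulr1.
Qed.

Lemma line_solution_right (r : R) : 0 < r -> F (- nu + r) = half_solution a 1 Jr r.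
Proof.
move=> r0.
rewrite /F /line_solution !indicE mem_set/= ?in_itv/= ?andbT ?ltrDl//.
rewrite memNset/= ?in_itv/=; last by apply/negP; rewrite -leNgt lerDl ltW.
rewrite memNset/=; last by move=> /eqP; rewrite -subr_eq0 opprK addrAC addNr add0r gt_eqF.
rewrite !mulr0 subr0 addr0 mulr1.
have rn : - nu < - nu + r by rewrite ltrDl.
have e : - nu + r + nu = r by rewrite addrAC addNr add0r.
have W0 := expPow_gt0 (a - 1) 1 r0.
rewrite /half_solution /Jr e.
have ip := integrable_density_itv Z_law r cH.
rewrite [LHS](_ : _ = (2 * r * p_ nu (- nu + r))^-1 *
   \int[mu]_(u in `[- nu, - nu + r]) (p_ nu u * H u)); last first.
  rewrite -RintegralZl//; apply: eq_Rintegral => u _.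
  by rewrite mulrAC [LHS]mulrC.
rewrite density_right// e -(mulr_expPow a 1 r0).
move: (\int[mu]_(u in _) _) => I.
move: cpos W0; move: (expPow _ _ _) => W; move: c => C C0 W0.
by field; rewrite !gt_eqF.
Qed.

Lemma line_solution_left (r : R) : 0 < r -> F (- nu - r) = half_solution a (- 1) Jl r.
Proof.
move=> r0.
have rn : - nu - r < - nu by rewrite ltrBlDr ltrDl.
rewrite /F /line_solution !indicE memNset/= ?in_itv/=; last first.
  by apply/negP; rewrite andbT -leNgt ltW.
rewrite mem_set/= ?in_itv//=.
rewrite memNset/=; last by move=> h; move: rn; rewrite h ltxx.
rewrite !mulr0 sub0r addr0 mulr1.
have e : - nu - r + nu = - r by rewrite addrAC addNr add0r.
have W0 := expPow_gt0 (a - 1) (- 1) r0.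
rewrite /half_solution /Jl e.
have ip := integrable_q_itv nu_gt0 r cH.
(* Here [x + nu = - r]; this sign cancels the minus in front of the second integral. *)
rewrite [X in - X = _](_ : _ = (2 * - r * q_ nu (- nu - r))^-1 *
   \int[mu]_(u in `[- nu - r, - nu]) (q_ nu u * H u)); last first.
  rewrite -RintegralZl//; apply: eq_Rintegral => u _.
  by rewrite mulrAC [LHS]mulrC.
rewrite q_left// e opprK -(mulr_expPow a (- 1) r0).
move: (\int[mu]_(u in _) _) => I.
move: cpos W0; move: (expPow _ _ _) => W; move: c => C C0 W0.
by field; rewrite !gt_eqF.
Qed.

Let Jr_df (r : R) : 0 < r ->
  is_derive r 1 Jr (expPow (a - 1) 1 r * H (- nu + r)).
Proof.
move=> r0.
have rn : - nu < - nu + r by rewrite ltrDl.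
have ip s := integrable_density_itv Z_law s cH.
have dp : derivable (fun u => p_ nu u * H u) (- nu + r) 1.
  apply: derivableM; first exact: derivable_density.
  by have [] := H_df (- nu + r).
have h := is_deriveZ c^-1 (is_derive_integral_right r0 ip dp).
apply: (is_derive_eq h).
rewrite /GRing.scale/= density_right// addrAC addNr add0r.
by move: cpos; move: c => C C0; field; rewrite gt_eqF.
Qed.

Let Jl_df (r : R) : 0 < r ->
  is_derive r 1 Jl (expPow (a - 1) (- 1) r * H (- nu - r)).
Proof.
move=> r0.
have rn : - nu - r < - nu by rewrite ltrBlDr ltrDl.
have ip s := integrable_q_itv nu_gt0 s cH.
have dp : derivable (fun u => q_ nu u * H u) (- nu - r) 1.
  apply: derivableM; first exact: derivable_q_.
  by have [] := H_df (- nu - r).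
have h := is_deriveZ c^-1 (is_derive_integral_left r0 ip dp).
apply: (is_derive_eq h).
rewrite /GRing.scale/= q_left// addrAC addNr add0r opprK.
by move: cpos; move: c => C C0; field; rewrite gt_eqF.
Qed.

Let Jr0 : Jr r @[r --> 0^'+] --> 0.
Proof.
rewrite -[X in _ --> X](mulr0 c^-1); apply: cvgMr; apply: integral_right_cvg0.
by move=> T; have := integrable_density_itv Z_law T cH; exact.
Qed.

Let Jl0 : Jl r @[r --> 0^'+] --> 0.
Proof.
rewrite -[X in _ --> X](mulr0 c^-1); apply: cvgMr; apply: integral_left_cvg0.
by move=> T; have := integrable_q_itv nu_gt0 T cH; exact.
Qed.

Let F_split (Q : R -> Prop) : Q (- nu) ->
  (forall r, 0 < r -> Q (- nu + r)) -> (forall r, 0 < r -> Q (- nu - r)) ->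
  forall x, Q x.
Proof.
move=> Q0 Qr Ql x; have [xn|xn|->//] := ltgtP x (- nu).
  have -> : x = - nu - (- nu - x) by rewrite opprB addrCA subrr addr0.
  by apply: Ql; rewrite subr_gt0.
have -> : x = - nu + (x + nu) by rewrite addrCA addNr addr0.
by apply: Qr; lra.
Qed.

(** On the right, [2 a - r] is negative beyond [r = nu], so a pointwise bound on [H] does not
    suffice and the cancellation in [partial_integral_norm_le] is used. On the left,
    [centered_norm_le] supplies the pointwise bound. *)
Lemma line_solution_norm_le x : `|F x| <= L.
Proof.
move: x; apply: F_split => [|r r0|r r0].
- rewrite line_solution_base normf_div (gtr0_norm nu_gt0) ler_pdivrMr//.
  apply: (centered_norm_le nu_gt0 Z_law k_df k_le) => u u0.
  by rewrite ler_norml; have := nu_gt0; lra.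
- rewrite line_solution_right// /half_solution.
  have A0 := expPow_gt0 a 1 r0.
  have A2 : 0 < 2 * expPow a 1 r by rewrite mulr_gt0.
  have ci : 0 < c^-1 by rewrite invr_gt0; exact: cpos.
  rewrite normf_div (gtr0_norm A2) ler_pdivrMr// /Jr normrM (gtr0_norm ci).
  rewrite (ler_pdivrMl _ _ cpos).
  rewrite (le_trans (partial_integral_norm_le nu_gt0 Z_law k_df k_le r0))//.
  by rewrite (_ : c * _ = L * (2 * c * expPow a 1 r)) //; move: c => C; ring.
- rewrite line_solution_left//.
  apply: (half_solution_norm_le a_gt0 Jl_df Jl0 r0) => s /andP[s0 sr].
  rewrite a2 mulN1r opprK.
  apply: (centered_norm_le nu_gt0 Z_law k_df k_le) => u u0.
  by rewrite ler_norml; lra.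
Qed.

(** Formally differentiating the equation at [x = - nu] gives [(nu + 2) f' = H' + f], with
    [f = H / nu] there. *)
Let kap := (dk (- nu) + H (- nu) / nu) / (2 * (a + 1)).

Definition line_solution_derive x : R :=
  if x == - nu then kap else (H x + x * F x) / (2 * (x + nu)).

Lemma is_derive_line_solution (x : R) : is_derive x 1 F (line_solution_derive x).
Proof.
move: x; apply: F_split => [|r r0|r r0].
- rewrite /line_solution_derive eqxx.
  have sl := (is_derive_slopeP H (- nu) (dk (- nu))).1 (H_df (- nu)).
  apply: is_derive_of_sides => e e0.
  + have slK e' : 0 < e' -> \forall r \near 0^'+,
        `|H (- nu + r) - H (- nu) - dk (- nu) * r| <= e' * r.
      move=> /sl[dl /= dl0 hd]; exists dl => //= r rd r0.
      by have := hd r rd; rewrite (gtr0_norm r0).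
    have h := half_solution_slope_at_right0 a_gt0 Jr_df Jr0 slK e0.
    near=> r; rewrite line_solution_right// line_solution_base.
    have : `|half_solution a 1 Jr r - H (- nu) / (2 * a) -
       (dk (- nu) + 1 * (H (- nu) / (2 * a))) / (2 * (a + 1)) * r| <= e * r.
      by near: r.
    by rewrite a2 mul1r.
  (* On the left both the slope of [K] and [s] change sign, so the slope in [r] is [- kap], that is,
     [kap] in [x]. *)
  + have slK e' : 0 < e' -> \forall r \near 0^'+,
        `|H (- nu - r) - H (- nu) - (- dk (- nu)) * r| <= e' * r.
      move=> /sl[dl /= dl0 hd]; exists dl => //= r rd r0.
      have := hd (- r); rewrite /ball_/= sub0r opprK normrN mulrN mulNr.
      by rewrite (gtr0_norm r0); apply; move: rd; rewrite /ball_/= sub0r normrN gtr0_norm.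
    have h := half_solution_slope_at_right0 a_gt0 Jl_df Jl0 slK e0.
    near=> r; rewrite line_solution_left// line_solution_base.
    have : `|half_solution a (- 1) Jl r - H (- nu) / (2 * a) -
       (- dk (- nu) + - 1 * (H (- nu) / (2 * a))) / (2 * (a + 1)) * r| <= e * r.
      by near: r.
    by rewrite a2 mulN1r -opprD !mulNr opprK.
- have e : - nu + r + nu = r by rewrite addrAC addNr add0r.
  have h0 : is_derive (- nu + r) 1 (fun x => x + nu) (1 : R).
    have := is_deriveD (is_derive_id (- nu + r) (1 : R)) (is_derive_cst nu (- nu + r) 1).
    by rewrite addr0.
  have hh := is_derive_half_solution Jr_df r0.
  rewrite -[in X in is_derive X](e) in hh.
  have h := @is_derive1_comp R _ (fun x => x + nu) _ _ _ hh h0.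
  have -> : line_solution_derive (- nu + r) =
      (H (- nu + r) - (2 * a - 1 * r) * half_solution a 1 Jr r) / (2 * r) * 1.
    rewrite /line_solution_derive -subr_eq0 opprK e gt_eqF// line_solution_right//.
    rewrite a2 mul1r mulr1.
    by congr (_ / _); ring.
  apply: near_eq_is_derive h.
  near=> x.
  have xn : 0 < x + nu.
    by rewrite -ltrBlDr sub0r; near: x; apply: lt_nbhsr; rewrite ltrDl.
  have ex : - nu + (x + nu) = x by rewrite addrCA addNr addr0.
  by rewrite -[LHS]/(half_solution a 1 Jr (x + nu)) -(line_solution_right xn) ex.
- have e : - (- nu - r + nu) = r by rewrite addrAC addNr add0r opprK.
  have h0 : is_derive (- nu - r) 1 (fun x => - (x + nu)) (- 1 : R).
    have := is_deriveN (is_deriveD (is_derive_id (- nu - r) (1 : R))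
      (is_derive_cst nu (- nu - r) 1)).
    by rewrite addr0.
  have hh := is_derive_half_solution Jl_df r0.
  rewrite -[in X in is_derive X](e) in hh.
  have h := @is_derive1_comp R _ (fun x => - (x + nu)) _ _ _ hh h0.
  have -> : line_solution_derive (- nu - r) =
      (H (- nu - r) - (2 * a - (- 1) * r) * half_solution a (- 1) Jl r) /
        (2 * r) * (- 1).
    have rn0 : r != 0 by rewrite gt_eqF.
    have e' : - nu - r + nu = - r by rewrite addrAC addNr add0r.
    rewrite /line_solution_derive -subr_eq0 opprK e' oppr_eq0 (negbTE rn0).
    rewrite line_solution_left// a2.
    by field.
  apply: near_eq_is_derive h.
  near=> x.
  have xn : 0 < - (x + nu).
    rewrite oppr_gt0 -ltrBrDr sub0r; near: x.
    by apply: lt_nbhsl; rewrite ltrBlDr ltrDl.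
  have ex : - nu - - (x + nu) = x by rewrite opprK addrCA addNr addr0.
  by rewrite -[LHS]/(half_solution a (- 1) Jl (- (x + nu))) -(line_solution_left xn) ex.
Unshelve. all: by end_near. Qed.

Lemma line_solution_equation x : 2 * (x + nu) * line_solution_derive x - x * F x = H x.
Proof.
rewrite /line_solution_derive; have [->|xn] := eqVneq x (- nu).
  rewrite addNr mulr0 mul0r sub0r mulNr opprK line_solution_base mulrC divfK//.
  by rewrite gt_eqF.
have xn0 : x + nu != 0 by rewrite addr_eq0.
by field.
Qed.

Lemma line_solution_derive_norm_le x : `|line_solution_derive x| <= L.
Proof.
move: x; apply: F_split => [|r r0|r r0].
- rewrite /line_solution_derive eqxx /kap.
  have a1 : 0 < 2 * (a + 1) by rewrite mulr_gt0// addr_gt0.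
  rewrite normf_div (gtr0_norm a1) ler_pdivrMr//.
  rewrite (le_trans (ler_normD _ _))// -line_solution_base.
  have := line_solution_norm_le (- nu); have := k_le (- nu).
  have : 0 <= L * a by rewrite mulr_ge0// ltW.
  by lra.
- have e : - nu + r + nu = r by rewrite addrAC addNr add0r.
  rewrite /line_solution_derive -subr_eq0 opprK e gt_eqF//.
  (* The derivative comparison requires [r / 2 <= a], that is, [r <= nu]. Beyond, the bounds
     [L (r + nu)] and [L (r - nu)] on the two terms of the numerator add up to exactly [2 r L]. *)
  have [rn|rn] := leP r nu.
    rewrite line_solution_right//.
    have -> : H (- nu + r) + (- nu + r) * half_solution a 1 Jr r =
      H (- nu + r) - (2 * a - 1 * r) * half_solution a 1 Jr r.
      by rewrite a2 mul1r; ring.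
    have K_df s : 0 < s <= r -> is_derive s 1 (fun r => H (- nu + r)) (dk (- nu + s)).
      move=> _.
      have hs : is_derive s 1 (fun r => - nu + r) (1 : R).
        have := is_deriveD (is_derive_cst (- nu) s 1) (is_derive_id s (1 : R)).
        by rewrite add0r.
      by have := is_derive1_comp (H_df (- nu + s)) hs; rewrite mulr1.
    apply: (@half_solution_derive_norm_le R a 1 (fun r => H (- nu + r)) Jr a_gt0 Jr_df
      Jr0 (fun r => dk (- nu + r)) L r r0 _ K_df).
    + by rewrite mul1r ler_pM2r.
    + apply/cvg_ex; exists (H (- nu + 0)); apply: cvg_at_right_filter.
      suff : {for 0, continuous (fun r : R => H (- nu + r))} by exact.
      apply: derivable_continuous.
      have hs : is_derive (0 : R) 1 (fun r => - nu + r) (1 : R).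
        have := is_deriveD (is_derive_cst (- nu) (0 : R) 1) (is_derive_id (0 : R) (1 : R)).
        by rewrite add0r.
      by have [] := is_derive1_comp (H_df (- nu + 0)) hs.
    + move=> s /andP[s0 sr]; rewrite mul1r (le_trans (ler_normD _ _))//.
      have := k_le (- nu + s); have := line_solution_norm_le (- nu + s).
      by rewrite line_solution_right//; lra.
  have r2 : 0 < 2 * r by rewrite mulr_gt0.
  rewrite normf_div (gtr0_norm r2) ler_pdivrMr//.
  rewrite (le_trans (ler_normD _ _))//.
  have h1 : `|H (- nu + r)| <= L * (r + nu).
    apply: (centered_norm_le nu_gt0 Z_law k_df k_le) => u u0.
    by rewrite ler_norml; lra.
  have h2 : `|(- nu + r) * F (- nu + r)| <= (r - nu) * L.
    have rn' : 0 < - nu + r by lra.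
    rewrite normrM (gtr0_norm rn') (addrC r) ler_pM2l//.
    exact: line_solution_norm_le.
  by rewrite (le_trans (lerD h1 h2))//; lra.
- have e : - nu - r + nu = - r by rewrite addrAC addNr add0r.
  have rn0 : r != 0 by rewrite gt_eqF.
  rewrite /line_solution_derive -subr_eq0 opprK e oppr_eq0 (negbTE rn0).
  rewrite line_solution_left//.
  have -> : (H (- nu - r) + (- nu - r) * half_solution a (- 1) Jl r) / (2 * - r) =
      - ((H (- nu - r) - (2 * a - (- 1) * r) * half_solution a (- 1) Jl r) / (2 * r)).
    by rewrite a2; field.
  rewrite normrN.
  have hs (s : R) : is_derive s 1 (fun r => - nu - r) (- 1 : R).
    have := is_deriveB (is_derive_cst (- nu) s 1) (is_derive_id s (1 : R)).
    by rewrite sub0r.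
  have K_df (s : R) : is_derive s 1 (fun r => H (- nu - r)) (- dk (- nu - s)).
    have := @is_derive1_comp R _ (fun r => - nu - r) _ _ _ (H_df (- nu - s)) (hs s).
    by rewrite mulrN1.
  apply: (@half_solution_derive_norm_le R a (- 1) (fun r => H (- nu - r)) Jl a_gt0 Jl_df
      Jl0 (fun r => - dk (- nu - r)) L r r0 _ (fun s _ => K_df s)).
  + by rewrite (@le_trans _ _ 0) ?(ltW a_gt0)//; have := r0; lra.
  + apply/cvg_ex; exists (H (- nu - 0)); apply: cvg_at_right_filter.
    suff : {for 0, continuous (fun r : R => H (- nu - r))} by exact.
    by apply: derivable_continuous; have [] := K_df 0.
  + move=> s /andP[s0 sr]; rewrite mulN1r -opprD normrN (le_trans (ler_normD _ _))//.
    have := k_le (- nu - s); have := line_solution_norm_le (- nu - s).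
    by rewrite line_solution_left//; lra.
Qed.

(** The difference of two bounded solutions solves the homogeneous equation, so it vanishes on each
    half-line; at [- nu] the derivative term drops out and the equation itself gives 0. *)
Lemma line_solution_unique (g dg : R -> R) (B : R) :
  (forall x, `|g x| <= B) -> (forall x : R, is_derive x 1 g (dg x)) ->
  (forall x, 2 * (x + nu) * dg x - x * g x = H x) -> forall x, g x = F x.
Proof.
move=> g_le g_df g_eq.
have D_le x : `|g x - F x| <= B + L.
  by rewrite (le_trans (ler_normB _ _))// lerD ?g_le ?line_solution_norm_le.
have D_eq x : 2 * (x + nu) * (dg x - line_solution_derive x) = x * (g x - F x).
  by have := g_eq x; have := line_solution_equation x; rewrite !mulrBr; lra.
apply: F_split => [|r r0|r r0]; apply/eqP; rewrite -subr_eq0; apply/eqP.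
- have := D_eq (- nu); rewrite addNr mulr0 mul0r => /esym/eqP.
  by rewrite mulf_eq0 oppr_eq0 gt_eqF//= => /eqP.
- apply: (@bounded_homogeneous_eq0 R a 1 a_gt0 (fun r => g (- nu + r) - F (- nu + r))
    (B + L) _ _ r r0) => [s _|s s0]; first exact: D_le.
  have hs : is_derive s 1 (fun r => - nu + r) (1 : R).
    have := is_deriveD (is_derive_cst (- nu) s 1) (is_derive_id s (1 : R)).
    by rewrite add0r.
  have h := is_derive1_comp (is_deriveB (g_df (- nu + s))
    (is_derive_line_solution (- nu + s))) hs.
  apply: (is_derive_eq h).
  have sn0 : s != 0 by rewrite gt_eqF.
  have e : - nu + s + nu = s by rewrite addrAC addNr add0r.
  have := D_eq (- nu + s); rewrite e a2 mulr1 mul1r => E.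
  have s20 : 2 * s != 0 by rewrite mulf_neq0.
  by apply: (mulfI s20); rewrite E; field.
- apply: (@bounded_homogeneous_eq0 R a (- 1) a_gt0 (fun r => g (- nu - r) - F (- nu - r))
    (B + L) _ _ r r0) => [s _|s s0]; first exact: D_le.
  have hs : is_derive s 1 (fun r => - nu - r) (- 1 : R).
    have := is_deriveB (is_derive_cst (- nu) s 1) (is_derive_id s (1 : R)).
    by rewrite sub0r.
  have h := @is_derive1_comp R _ (fun r => - nu - r) _ _ _
    (is_deriveB (g_df (- nu - s)) (is_derive_line_solution (- nu - s))) hs.
  apply: (is_derive_eq h).
  have sn0 : s != 0 by rewrite gt_eqF.
  have e : - nu - s + nu = - s by rewrite addrAC addNr add0r.
  have := D_eq (- nu - s); rewrite e a2 => E.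
  have s20 : 2 * - s != 0 by rewrite mulf_neq0 ?oppr_eq0.
  by apply: (mulfI s20); rewrite mulrN1 mulrN E; field.
Qed.

End solution.

(** * The equation with parameters *)

Lemma is_derive_line (R : realType) (V : normedModType R) (f : V -> R)
    (a v : V) (s l : R) :
  is_derive (s *: v + a) v f l <-> is_derive s 1 (fun s => f (s *: v + a)) l.
Proof.
have E : (fun h : R => h^-1 *: (f (h *: v + (s *: v + a)) - f (s *: v + a))) =
  (fun h : R => h^-1 *: (f ((h *: (1 : R) + s) *: v + a) - f (s *: v + a))).
  by apply/funext => h; rewrite scalerDl addrA /GRing.scale/= mulr1.
split=> -[dfl fl].
- by apply: DeriveDef; [rewrite /derivable -E|rewrite -fl /derive -E].
- by apply: DeriveDef; [rewrite /derivable E|rewrite -fl /derive E].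
Qed.

Lemma is_derive_dxP (R : realType) (n : nat) (f : R * 'rV[R]_n -> R) (x : R)
    (y : 'rV[R]_n) (l : R) :
  is_derive (x, y) dx f l <-> is_derive x 1 (fun x => f (x, y)) l.
Proof.
have E (s : R) : s *: dx + (0, y) = (s, y) :> R * 'rV[R]_n.
  by congr (_, _); rewrite /= ?scaler0 ?add0r// addr0 /GRing.scale/= mulr1.
have := is_derive_line f (0, y) dx x l; rewrite E.
by under eq_fun do rewrite E.
Qed.

Lemma is_derive_dyP (R : realType) (n : nat) (f : R * 'rV[R]_n -> R) (j : 'I_n)
    (x s : R) (y : 'rV[R]_n) (l : R) :
  is_derive (x, s *: delta_mx 0 j + y) (dy j) f l <->
  is_derive s 1 (fun s => f (x, s *: delta_mx 0 j + y)) l.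
Proof.
have E (s' : R) : s' *: dy j + (x, y) = (x, s' *: delta_mx 0 j + y) :> R * 'rV[R]_n.
  by congr (_, _); rewrite /= scaler0 add0r.
have := is_derive_line f (x, y) (dy j) s l; rewrite E.
by under eq_fun do rewrite E.
Qed.

Lemma is_derive_Rintegral (R : realType) (d : measure_display)
    (Y : measurableType d) (mu : {measure set Y -> \bar R}) (B : set Y)
    (f df : R -> Y -> R) (G : Y -> R) (a : R) :
  measurable B -> (forall x, mu.-integrable B (EFin \o f x)) ->
  (forall (x : R) y, B y -> is_derive x 1 (f ^~ y) (df x y)) ->
  mu.-integrable B (EFin \o G) -> (forall y, 0 <= G y) ->
  (forall x y, B y -> `|df x y| <= G y) ->
  is_derive a 1 (fun x => \int[mu]_(y in B) f x y) (\int[mu]_(y in B) df a y).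
Proof.
move=> mB intf f_df intG G0 df_le.
(* The domination holds for all parameters, so any open interval around [a] serves. *)
have Ia : `]a - 1, a + 1[%classic a.
  by rewrite /= in_itv/= ltrBlDr ltrDl ltr01.
have d1 x y : B y -> partial1of2 f x y = df x y.
  by move=> By; rewrite partial1of2E; have [_] := f_df x y By.
have der x y : `]a - 1, a + 1[%classic x -> B y -> derivable (f ^~ y) x 1.
  by move=> _ By; have [] := f_df x y By.
have ub x y : `]a - 1, a + 1[%classic x -> B y -> `|partial1of2 f x y| <= G y.
  by move=> _ By; rewrite d1// df_le.
apply: DeriveDef.
  exact: (derivable_under_integral mB Ia (fun x _ => intf x) der G0 intG ub).
rewrite -derive1E.
rewrite (differentiation_under_integral mB Ia (fun x _ => intf x) der G0 intG ub).
by apply: eq_Rintegral => y /[!inE] By; exact: d1.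
Qed.

Lemma supnorm_le (R : realType) (n : nat) (g : R * 'rV[R]_n -> R) (L : R) :
  (forall p, `|g p| <= L) -> (supnorm g <= L%:E)%E.
Proof.
by move=> g_le; apply: ge_ereal_sup => _ [p _ <-]; rewrite lee_fin.
Qed.

Lemma supnormP (R : realType) (n : nat) (g : R * 'rV[R]_n -> R) :
  bounded_fun g -> exists2 L : R, supnorm g = L%:E & forall p, `|g p| <= L.
Proof.
move=> [M [_ gM]].
(* [bounded_fun] provides bounds only strictly above [M], hence [M + 1]. *)
have g_le p : `|g p| <= M + 1 by apply: gM; rewrite ?ltrDl.
have le p : (`|g p|%:E <= supnorm g)%E by apply: ereal_sup_ubound; exists p.
have fin : supnorm g \is a fin_num.
  rewrite fin_real//; apply/andP; split.
    by apply: lt_le_trans (le (0, 0)); rewrite ltNyr.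
  by apply: le_lt_trans (supnorm_le g_le) _; rewrite ltry.
exists (fine (supnorm g)); first by rewrite fineK.
by move=> p; rewrite -lee_fin fineK.
Qed.

(** * From one variable back to [f_h] *)

Section stein_equation.
Variables (R : realType) (nu : R).
Hypothesis nu_gt0 : 0 < nu.
Variables (n : nat) (d : measure_display) (Om : measurableType d).
Variables (P : probability Om R) (Z : {RV P >-> R}).
Hypothesis Z_law : centered_gamma nu Z.

Local Notation mu := (@lebesgue_measure R).

Lemma stein_solutionE (h : R * 'rV[R]_n -> R) x y :
  stein_solution nu Z h (x, y) = line_solution nu (fun u => centered Z h u y) x.
Proof. by []. Qed.

Section lipschitz.
Variables (h : R * 'rV[R]_n -> R) (L : R).
Hypothesis h_dx : forall p, derivable h p dx.
Hypothesis h_le : forall p, `|'D_dx h p| <= L.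

Lemma is_derive_fst y (x : R) :
  is_derive x 1 (fun x => h (x, y)) ('D_dx h (x, y)).
Proof. by apply/is_derive_dxP; apply: DeriveDef. Qed.

Let dh_le y x : `|'D_dx h (x, y)| <= L. Proof. exact: h_le. Qed.

(** The bound on the derivative in [x] makes each slice Lipschitz, so its expectation is an integral
    against the density. *)
Lemma centeredE y : (fun u => centered Z h u y) =
  (fun u => h (u, y) - \int[mu]_v (h (v, y) * p_ nu v)).
Proof.
apply/funext => u; congr (_ - _).
by rewrite -(expectation_density Z_law (density_integrable_lipschitz nu_gt0 Z_law
  (is_derive_fst y) (dh_le y))).
Qed.

Lemma stein_solution_norm_le p : `|stein_solution nu Z h p| <= L.
Proof.
case: p => x y; rewrite stein_solutionE centeredE.
exact: (line_solution_norm_le nu_gt0 Z_law (is_derive_fst y) (dh_le y)).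
Qed.

Lemma stein_solution_derive_dx x y : exists2 l : R,
  is_derive (x, y) dx (stein_solution nu Z h) l &
  `|l| <= L /\
  2 * (x + nu) * l - x * stein_solution nu Z h (x, y) = centered Z h x y.
Proof.
have E : (fun x => stein_solution nu Z h (x, y)) =
    line_solution nu (fun u => h (u, y) - \int[mu]_v (h (v, y) * p_ nu v)).
  by apply/funext => x'; rewrite stein_solutionE centeredE.
exists (line_solution_derive nu (fun x => h (x, y)) (fun x => 'D_dx h (x, y)) x).
  apply/is_derive_dxP; rewrite E.
  exact: (is_derive_line_solution nu_gt0 Z_law (is_derive_fst y)).
split; first exact: (line_solution_derive_norm_le nu_gt0 Z_law (is_derive_fst y) (dh_le y)).
have := congr1 (fun f => f x) E => /= ->.
have := congr1 (fun f => f x) (centeredE y) => /= ->.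
exact: (line_solution_equation nu_gt0).
Qed.

Lemma stein_solution_bounded :
  bounded_solution nu Z h (stein_solution nu Z h).
Proof.
split.
  exists L; split=> [|M LM p _]; first exact: num_real.
  exact: le_trans (stein_solution_norm_le p) (ltW LM).
move=> x y; have [l [df <-] [_ e]] := stein_solution_derive_dx x y.
by split.
Qed.

Lemma stein_solution_unique g :
  bounded_solution nu Z h g -> g = stein_solution nu Z h.
Proof.
move=> [[M [_ gM]] g_eq]; apply/funext => -[x y].
rewrite stein_solutionE centeredE.
apply: (@line_solution_unique R nu nu_gt0 d Om P Z Z_law (fun x => h (x, y))
  (fun x => 'D_dx h (x, y)) L (is_derive_fst y) (dh_le y)
  (fun x => g (x, y)) (fun x => 'D_dx g (x, y)) (M + 1)).
- by move=> x'; apply: gM; rewrite ?ltrDl.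
- by move=> x'; apply/is_derive_dxP; apply: DeriveDef => //; have [] := g_eq x' y.
- move=> x'; have [_ ->] := g_eq x' y.
  by have := congr1 (fun f => f x') (centeredE y).
Qed.

Lemma integrable_fst y : P.-integrable setT (EFin \o (fun w => h (Z w, y))).
Proof.
have ik := density_integrable_lipschitz nu_gt0 Z_law (is_derive_fst y) (dh_le y).
exact: (integrable_comp_law Z_law ik).
Qed.

End lipschitz.

(** * The derivative of [f_h] in [y_j] *)

Section derivative_y.
Variables (h : R * 'rV[R]_n -> R) (j : 'I_n) (L L' M : R).
Hypothesis h_dx : forall p, derivable h p dx.
Hypothesis h_le : forall p, `|'D_dx h p| <= L.
Hypothesis h_dy : forall p, derivable h p (dy j).
Hypothesis hy_le : forall p, `|'D_(dy j) h p| <= M.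
Hypothesis hy_dx : forall p, derivable ('D_(dy j) h) p dx.
Hypothesis hy_dx_le : forall p, `|'D_dx ('D_(dy j) h) p| <= L'.

Let M0 : 0 <= M. Proof. exact: le_trans (hy_le 0). Qed.

Let Y (y : 'rV[R]_n) (s : R) := s *: delta_mx 0 j + y.

Let centered_dy (u : R) (y : 'rV[R]_n) (s : R) :
  is_derive s 1 (fun s => centered Z h u (Y y s))
    (centered Z ('D_(dy j) h) u (Y y s)).
Proof.
rewrite /centered unlock; apply: is_deriveB.
  by apply/is_derive_dyP; apply: DeriveDef.
apply: (@is_derive_Rintegral R d Om P setT (fun s w => h (Z w, Y y s))
  (fun s w => 'D_(dy j) h (Z w, Y y s)) (cst M)) => //.
- by move=> t; exact: (integrable_fst h_dx h_le (Y y t)).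
- by move=> t w _; apply/is_derive_dyP; apply: DeriveDef.
- exact: finite_measure_integrable_cst.
Qed.

Let centered_dy_le u y : `|centered Z ('D_(dy j) h) u y| <= M + M.
Proof.
rewrite (le_trans (ler_normB _ _))// lerD// unlock.
have ih := integrable_fst hy_dx hy_dx_le y.
rewrite (le_trans (le_normr_Rintegral measurableT ih))//.
have icst : P.-integrable setT (EFin \o cst M) by exact: finite_measure_integrable_cst.
have E : \int[P]_(w in setT) cst M w = M.
  rewrite (Rintegral_cst P measurableT) -[RHS]mulr1; congr (_ * _).
  exact: (congr1 fine (probability_setT P)).
rewrite -[leRHS]E; apply: le_Rintegral => //.
by have /integrable_norm := ih; apply: eq_integrable.
Qed.

Let continuous_centered y : continuous (fun u => centered Z h u y).
Proof.
move=> u; apply: cvgB; last exact: cvg_cst.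
by apply: derivable_continuous; have [] := is_derive_fst h_dx y u.
Qed.

(** [w] stands for [p_ nu] or [q_ nu] and [D] for the denominator. Where [D] is 0, so is [D^-1], and
    both integrands vanish. The dominating function is [w] times a constant, integrable by the
    assumption on continuous factors. *)
Let integral_dy (B : set R) (w : R -> R) (D s : R) y : measurable B ->
  (forall u, 0 <= w u) ->
  (forall H : R -> R, continuous H ->
     mu.-integrable B (EFin \o (fun u => w u * H u))) ->
  is_derive s 1 (fun s => \int[mu]_(u in B) (w u / D * centered Z h u (Y y s)))
    (\int[mu]_(u in B) (w u / D * centered Z ('D_(dy j) h) u (Y y s))).
Proof.
move=> mB w0 iw.
apply: (@is_derive_Rintegral R _ (measurableTypeR R) mu B
  (fun s u => w u / D * centered Z h u (Y y s))
  (fun s u => w u / D * centered Z ('D_(dy j) h) u (Y y s))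
  (fun u => w u * (`|D^-1| * (M + M)))) => //.
- move=> t; have h1 := iw _ (@continuous_centered (Y y t)).
  have h2 := integrableZl _ D^-1 h1.
  apply: eq_integrable (h2 _) => // u _ /=; rewrite -EFinM; congr EFin.
  by rewrite mulrA (mulrC _ (w u)).
- move=> t u _; have h1 := is_deriveZ (w u / D) (centered_dy u y t).
  by apply: (is_derive_eq h1).
- by apply: (iw (cst (`|D^-1| * (M + M)))) => x; exact: cvg_cst.
- by move=> u; rewrite mulr_ge0// mulr_ge0// addr_ge0.
- move=> t u _; rewrite !normrM (ger0_norm (w0 u)) -mulrA ler_wpM2l//.
  by rewrite ler_wpM2l// centered_dy_le.
Qed.

Lemma is_derive_stein_solution_dy p :
  is_derive p (dy j) (stein_solution nu Z h) (stein_solution nu Z ('D_(dy j) h) p).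
Proof.
case: p => x y.
(* The base point becomes parameter 0 on a line in the direction [y_j], which reduces the claim to a
   derivative in one real variable. *)
have Y0 : Y y 0 = y by rewrite /Y scale0r add0r.
rewrite -{1 2}Y0; apply/is_derive_dyP.
have t1 := @integral_dy `[- nu, x] (p_ nu) (2 * (x + nu) * p_ nu x) 0 y
  (measurable_itv _) (density_ge0 nu).
have t2 := @integral_dy `[x, - nu] (q_ nu) (2 * (x + nu) * q_ nu x) 0 y
  (measurable_itv _) (q_ge0 nu).
(* On the wrong side of [- nu] the length [x + nu] is negative and the interval is empty, so all [x]
   are treated together. *)
have i1 (H : R -> R) : continuous H ->
    mu.-integrable `[- nu, x] (EFin \o (fun u => p_ nu u * H u)).
  move=> cH; have := integrable_density_itv Z_law (x + nu) cH.
  by rewrite (_ : - nu + (x + nu) = x)// addrCA addNr addr0.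
have i2 (H : R -> R) : continuous H ->
    mu.-integrable `[x, - nu] (EFin \o (fun u => q_ nu u * H u)).
  move=> cH; have := integrable_q_itv nu_gt0 (- nu - x) cH.
  by rewrite (_ : - nu - (- nu - x) = x)// opprB addrCA subrr addr0.
have {}t1 := t1 i1.
have {}t2 := t2 i2.
have t3 := centered_dy (- nu) y 0.
have D := is_deriveD (is_deriveB
  (is_deriveZ (\1_(`]- nu, +oo[) x) t1) (is_deriveZ (\1_(`]-oo, - nu[) x) t2))
  (is_deriveZ (\1_([set - nu]) x / nu) t3).
rewrite -[X in is_derive _ _ X _]/(fun s => stein_solution nu Z h (x, Y y s)).
rewrite [X in is_derive _ _ X _](_ : _ =
  (\1_(`]- nu, +oo[) x : R) \*: (fun s => \int[mu]_(u in `[- nu, x])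
       (p_ nu u / (2 * (x + nu) * p_ nu x) * centered Z h u (Y y s)))
  - (\1_(`]-oo, - nu[) x : R) \*: (fun s => \int[mu]_(u in `[x, - nu])
       (q_ nu u / (2 * (x + nu) * q_ nu x) * centered Z h u (Y y s)))
  + (\1_([set - nu]) x / nu) \*: (fun s => centered Z h (- nu) (Y y s))); last first.
  apply/funext => s; rewrite /stein_solution !fctE /GRing.scale/=.
  by congr (_ - _ + _); rewrite mulrC// [RHS]mulrAC mulrA.
apply: (is_derive_eq D).
rewrite Y0 /stein_solution /GRing.scale/=.
by congr (_ - _ + _); rewrite mulrC// [RHS]mulrAC mulrA.
Qed.

End derivative_y.

End stein_equation.

Theorem proposition2 (R : realType) (nu : R) (nu_gt0 : 0 < nu) :
  exists C : R, 0 < C /\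
  forall (n : nat) (n_gt0 : (0 < n)%N)
         (d : measure_display) (Om : measurableType d) (P : probability Om R)
         (Z : {RV P >-> R}) (Z_law : centered_gamma nu Z)
         (h : R * 'rV[R]_n -> R) (h_C2 : C2 h) (h_bnd : bounded_partials h),
  let f := stein_solution nu Z h in
  [/\ bounded_solution nu Z h f
        /\ (forall g, bounded_solution nu Z h g -> g = f),
      (supnorm f <= C%:E * supnorm ('D_dx h))%E,
      (forall j : 'I_n,
         (forall p, derivable f p (dy j)) /\
         (supnorm ('D_(dy j) f) <= C%:E * supnorm ('D_dx ('D_(dy j) h)))%E)
    & (supnorm ('D_dx f) <= C%:E * supnorm ('D_dx h))%E].
Proof.
exists 1; split=> // n _ d Om P Z Z_law h [h_C1 dh_C1] [h_b1 h_b2] f.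
have h_dx p : derivable h p dx by have [] := h_C1 None.
have [L -> h_le] := supnormP (h_b1 None).
rewrite mul1e; split.
- split; first exact: (stein_solution_bounded nu_gt0 Z_law h_dx h_le).
  exact: (stein_solution_unique nu_gt0 Z_law h_dx h_le).
- by apply: supnorm_le; exact: (stein_solution_norm_le nu_gt0 Z_law h_dx h_le).
- move=> j; have h_dy p : derivable h p (dy j) by have [] := h_C1 (Some j).
  have [M _ hy_le] := supnormP (h_b1 (Some j)).
  have hy_dx p : derivable ('D_(dy j) h) p dx by have [] := dh_C1 (Some j) None.
  (* The mixed derivative appears with [y_j] taken first, the order produced by applying the bound
     on solutions to ['D_(dy j) h]. *)
  have [L' -> hy_dx_le] := supnormP (h_b2 None (Some j)).
  have df := is_derive_stein_solution_dy nu_gt0 Z_law h_dx h_le h_dy hy_le hy_dx hy_dx_le.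
  rewrite mul1e; split=> [p|]; first by have [] := df p.
  apply: supnorm_le => p; have [_ ->] := df p.
  exact: (stein_solution_norm_le nu_gt0 Z_law hy_dx hy_dx_le).
- apply: supnorm_le => -[x y].
  by have [l [_ ->] []] := stein_solution_derive_dx nu_gt0 Z_law h_dx h_le x y.
Qed.
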